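(* Let $\mathcal A$ be a surjective closed operator ideal such that $\mathcal A\subset\mathcal A^{dual\ dual}$ and let $X$ be a Banach space. If $X^*$ has the $\mathcal A$-AP, then $X$ has the MAP for $\mathcal A^{dual}$.
   Context: All Banach spaces are over the same field, real or complex. $\mathcal F(X;Y)$ denotes the finite rank bounded operators, $\mathcal F(X)=\mathcal F(X;X)$. An operator ideal is closed if it is a Banach operator ideal with respect to the usual operator norm $\|\cdot\|$ (and it is considered with this norm). $T\in\mathcal A^{dual}(X;Y)$ iff $T^*\in\mathcal A(Y^*;X^* )$; $\mathcal A^{dual}$ is again closed (equipped with the operator norm), and $\mathcal A^{dual\ dual}=(\mathcal A^{dual})^{dual}$. Inclusion $\mathcal A\subset\mathcal B$ means $\mathcal A(X;Y)\subset\mathcal B(X;Y)$ for all Banach spaces $X,Y$. $\mathcal A$ is surjective if for every metric surjection (quotient map) $Q\colon Z\to X$ and every bounded operator $T\colon X\to Y$ with $TQ\in\mathcal A(Z;Y)$ one has $T\in\mathcal A(X;Y)$. A Banach space $E$ has the $\mathcal A$-approximation property ($\mathcal A$-AP) if $\mathcal F(Y;E)$ is norm-dense in $\mathcal A(Y;E)$, with respect to the norm of $\mathcal A$ (here the operator norm), for every Banach space $Y$. For a Banach operator ideal $(\mathcal B,\|\cdot\|_{\mathcal B})$, $X$ has the MAP for $\mathcal B$ if for every Banach space $Y$ and each $T\in\mathcal B(X;Y)$ there is a net $(S_\alpha)$ in $\mathcal F(X)$ such that $S_\alpha\to I_X$ uniformly on compact subsets of $X$ and $\limsup_\alpha\|TS_\alpha\|_{\mathcal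 B}\le\|T\|_{\mathcal B}$. *)

(* Defs.v *)
From HB Require Import structures.
From mathcomp Require Import all_boot all_order all_algebra.
From mathcomp Require Import complex.
From mathcomp Require Import all_classical all_reals all_analysis.

Set Implicit Arguments.
Unset Strict Implicit.
Unset Printing Implicit Defensive.

Import Order.TTheory GRing.Theory Num.Theory.
Import numFieldNormedType.Exports.

Local Open Scope classical_set_scope.
Local Open Scope ring_scope.

(* The scalar field is R or R[i].  Norms of a normedModType K take values in
   K itself; `re` and `ofR` move them to the reals and back. *)
Inductive scalar_kind := RealScalars | ComplexScalars.

Definition scalar_field (R : realType) (k : scalar_kind) : numFieldType :=
  match k with
  | RealScalars => R
  | ComplexScalars => R[i]
  end.

Definition re (R : realType) (k : scalar_kind) : scalar_field R k -> R :=
  match k with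
  | RealScalars => fun x => x
  | ComplexScalars => fun z => complex.Re z
  end.

Definition ofR (R : realType) (k : scalar_kind) : R -> scalar_field R k :=
  match k with
  | RealScalars => fun x => x
  | ComplexScalars => fun x => real_complex R x
  end.
Arguments ofR {R} k _.

Definition rnorm (R : realType) (k : scalar_kind)
  (V : normedZmodType (scalar_field R k)) (x : V) : R := re `|x|.

Section Scalars.
Variables (R : realType) (k : scalar_kind).
Local Notation K := (scalar_field R k).

Lemma re_ofR (a : R) : re (ofR k a) = a.
Proof. by case: k. Qed.

Lemma ofR_re (x : K) : 0 <= x -> ofR k (re x) = x.
Proof.
by case: k x => //= x x0; rewrite RRe_real// ger0_real.
Qed.

Lemma ofRD (a b : R) : ofR k (a + b) = ofR k a + ofR k b.
Proof. by case: k => //=; rewrite rmorphD. Qed.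

Lemma ofRM (a b : R) : ofR k (a * b) = ofR k a * ofR k b.
Proof. by case: k => //=; rewrite rmorphM. Qed.

Lemma ofR_le (a b : R) : (ofR k a <= ofR k b) = (a <= b).
Proof. by case: k => //=; rewrite lecR. Qed.

Lemma ofR_lt (a b : R) : (ofR k a < ofR k b) = (a < b).
Proof. by case: k => //=; rewrite ltcR. Qed.

Lemma ofR0 : ofR k (0 : R) = 0.
Proof. by case: k. Qed.

Lemma ofR1 : ofR k (1 : R) = 1.
Proof. by case: k. Qed.

Lemma ofR_gt0 (a : R) : (0 < ofR k a) = (0 < a).
Proof. by rewrite -ofR0 ofR_lt. Qed.

Lemma ofR_rnorm (V : normedZmodType K) (x : V) : ofR k (rnorm x) = `|x|.
Proof. by rewrite ofR_re. Qed.

Lemma le_rnorm (V W : normedZmodType K) (x : V) (y : W) :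
  (rnorm x <= rnorm y) = (`|x| <= `|y|).
Proof. by rewrite -ofR_le !ofR_rnorm. Qed.

Lemma rnorm_ge0 (V : normedZmodType K) (x : V) : 0 <= rnorm x.
Proof. by rewrite -ofR_le ofR0 ofR_rnorm. Qed.

Lemma ler_rnormD (V : normedZmodType K) (x y : V) :
  rnorm (x + y) <= rnorm x + rnorm y.
Proof. by rewrite -ofR_le ofRD !ofR_rnorm ler_normD. Qed.

Lemma rnormZ (V : normedModType K) (a : K) (x : V) :
  rnorm (a *: x) = rnorm a * rnorm x.
Proof. by rewrite -[LHS]re_ofR ofR_rnorm normrZ -!ofR_rnorm -ofRM re_ofR. Qed.

Lemma rnorm0_eq0 (V : normedZmodType K) (x : V) : rnorm x = 0 -> x = 0.
Proof. by move=> x0; apply/normr0_eq0; rewrite -ofR_rnorm x0 ofR0. Qed.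

End Scalars.

Lemma complex_cauchy_cvg (R : realType) (F : set_system R[i]^o) :
  ProperFilter F -> cauchy F -> cvg F.
Proof.
move=> FF Fc.
have cauchy_part (f : R[i]^o -> R) :
    (forall x y : R[i], `|f x - f y|%:C%C <= `|x - y|) -> cauchy (f @ F).
  move=> fle; apply/cauchy_ballP => e e0.
  have eC : 0 < e%:C%C :> R[i] by rewrite ltcR.
  move/cauchy_ballP : Fc => /(_ _ eC) [[A B] [/= FA FB] AB].
  exists (f @` A, f @` B) => /=.
    by split; [apply: filterS FA|apply: filterS FB] => x Ax /=; exists x.
  move=> [_ _] /= [[x Ax <-] [y By <-]].
  have := AB (x, y) (conj Ax By).
  rewrite -!ball_normE /= => xye; rewrite -ltcR.
  exact: le_lt_trans (fle _ _) xye.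
have leRe (x y : R[i]) : `|complex.Re x - complex.Re y|%:C%C <= `|x - y|.
  by rewrite -raddfB normc_ge_Re.
have leIm (x y : R[i]) : `|complex.Im x - complex.Im y|%:C%C <= `|x - y|.
  rewrite -raddfB normc_def lecR -sqrtr_sqr ler_wsqrtr//.
  by rewrite lerDr sqr_ge0.
have /cvg_ex[/= a Fa] : cvg (@complex.Re R @ F).
  by apply: R_complete; exact: cauchy_part leRe.
have /cvg_ex[/= b Fb] : cvg (@complex.Im R @ F).
  by apply: R_complete; exact: cauchy_part leIm.
apply/cvg_ex; exists (Complex a b); apply/cvgrPdist_lt => e e0.
have [e' e'0 ee'] : exists2 e', 0 < e' & e = e'%:C%C.
  exists (complex.Re e); last by rewrite RRe_real// gtr0_real.
  by rewrite -ltcR RRe_real// gtr0_real.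
have e2 : 0 < e' / 2 by rewrite divr_gt0.
move/cvgrPdist_lt : Fa => /(_ _ e2) Fa.
move/cvgrPdist_lt : Fb => /(_ _ e2) Fb.
near=> z.
have za : `|a - complex.Re z| < e' / 2 by near: z.
have zb : `|b - complex.Im z| < e' / 2 by near: z.
rewrite ee' (complexE (_ - z)); apply: le_lt_trans (ler_normD _ _) _.
have ni : `|'i%C| = 1 :> R[i].
  by rewrite normc_def/= expr0n/= expr1n add0r sqrtr1.
rewrite normrM ni mul1r !raddfB !normc_def/= subr0 !expr0n/= !addr0 !sqrtr_sqr.
rewrite -rmorphD/= ltcR [ltRHS]splitr.
exact: ltrD.
Unshelve. all: by end_near. Qed.

Lemma scalar_cauchy_cvg (R : realType) (k : scalar_kind)
    (F : set_system (scalar_field R k)^o) : ProperFilter F -> cauchy F -> cvg F.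
Proof. by case: k F => F; [exact: R_complete|exact: complex_cauchy_cvg]. Qed.

(* The scalar field as a one-dimensional Banach space. *)
Definition scalar_space (R : realType) (k : scalar_kind) : Type :=
  (scalar_field R k)^o.

HB.instance Definition _ (R : realType) (k : scalar_kind) :=
  NormedModule.copy (scalar_space R k) (scalar_field R k)^o.
HB.instance Definition _ (R : realType) (k : scalar_kind) :=
  Uniform_isComplete.Build (scalar_space R k) (@scalar_cauchy_cvg R k).

Section BoundedOperators.
Variables (R : realType) (k : scalar_kind).
Local Notation K := (scalar_field R k).

Definition bounded_linear (X Y : normedModType K) : {pred X -> Y} :=
  fun f => `[< linear f /\ exists M : R, forall x, rnorm (f x) <= M * rnorm x >].

Record bop (X Y : normedModType K) :=
  Bop { bop_fun :> X -> Y; bopP : bop_fun \in @bounded_linear X Y }.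

Section Structure.
Variables X Y : normedModType K.

HB.instance Definition _ := [isSub of bop X Y for @bop_fun X Y].
HB.instance Definition _ := [Choice of bop X Y by <:].

Lemma bounded_linearP (f : X -> Y) :
  reflect (linear f /\ exists M : R, forall x, rnorm (f x) <= M * rnorm x)
          (f \in @bounded_linear X Y).
Proof. exact: asboolP. Qed.

Lemma bounded_linear_submod_closed : submod_closed (@bounded_linear X Y).
Proof.
split=> [|a f g /bounded_linearP[fl [M fM]] /bounded_linearP[gl [N gN]]];
  apply/bounded_linearP; split.
- by move=> a u v; rewrite /= scaler0 addr0.
- exists 0 => x; rewrite mul0r.
  by rewrite -(ofR_le k) ofR_rnorm normr0 ofR0.
- move=> b u v /=.
  rewrite !fctE fl gl !scalerDr !scalerA mulrC addrACA.
  by [].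
- exists (rnorm (a : K^o) * M + N) => x.
  apply: le_trans (ler_rnormD _ _) _; rewrite rnormZ mulrDl.
  by rewrite lerD// -mulrA ler_wpM2l// rnorm_ge0.
Qed.

HB.instance Definition _ := GRing.isSubmodClosed.Build K (X -> Y)
  (@bounded_linear X Y) bounded_linear_submod_closed.
HB.instance Definition _ := [SubChoice_isSubLmodule of bop X Y by <:].

Lemma bop_linear (T : bop X Y) : linear T.
Proof. by have /bounded_linearP[] := bopP T. Qed.

HB.instance Definition _ (T : bop X Y) :=
  GRing.isLinear.Build K X Y *:%R (bop_fun T) (@bop_linear T).

Lemma bop_bounded (T : bop X Y) :
  exists M : R, forall x, rnorm (T x) <= M * rnorm x.
Proof. by have /bounded_linearP[] := bopP T. Qed.

Definition opnorm (T : bop X Y) : R :=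
  sup [set rnorm (T x) | x in [set x : X | rnorm x <= 1]].

Lemma opnorm_has_sup (T : bop X Y) :
  has_sup [set rnorm (T x) | x in [set x : X | rnorm x <= 1]].
Proof.
split; first by exists (rnorm (T 0)), 0 => //=; rewrite /rnorm normr0 -(ofR0 _ k) re_ofR.
have [M TM] := bop_bounded T; exists `|M| => _ [x /= x1 <-].
apply: le_trans (TM x) _; apply: le_trans (ler_wpM2r (rnorm_ge0 _) (ler_norm M)) _.
by rewrite -[leRHS]mulr1 ler_wpM2l.
Qed.

Lemma opnorm_ge0 (T : bop X Y) : 0 <= opnorm T.
Proof.
apply: le_trans (rnorm_ge0 (T 0)) _.
apply: (sup_upper_bound (opnorm_has_sup T)); exists 0 => //=.
by rewrite /rnorm normr0 -(ofR0 _ k) re_ofR.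
Qed.

Lemma le_opnorm (T : bop X Y) (x : X) : rnorm (T x) <= opnorm T * rnorm x.
Proof.
have [x0|x0] := eqVneq (rnorm x) 0.
  by rewrite x0 (rnorm0_eq0 x0) linear0 mulr0 /rnorm normr0 -(ofR0 _ k) re_ofR.
have xgt0 : 0 < rnorm x by rewrite lt_neqAle eq_sym x0 rnorm_ge0.
have nV : rnorm (ofR k (rnorm x)^-1 : K^o) = (rnorm x)^-1.
  by rewrite /rnorm ger0_norm ?re_ofR// -(ofR0 _ k) ofR_le invr_ge0 ltW.
rewrite -ler_pdivrMr// mulrC -nV -rnormZ -linearZ.
apply: (sup_upper_bound (opnorm_has_sup T)); exists (ofR k (rnorm x)^-1 *: x) => //=.
by rewrite rnormZ nV mulVf.
Qed.

Lemma opnorm_le (T : bop X Y) (M : R) : 0 <= M ->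
  (forall x, rnorm (T x) <= M * rnorm x) -> opnorm T <= M.
Proof.
move=> M0 TM; apply: ge_sup; first exact: (opnorm_has_sup T).1.
move=> _ [x /= x1 <-]; apply: le_trans (TM x) _.
by rewrite -[leRHS]mulr1 ler_wpM2l.
Qed.

Lemma ler_opnormD (S T : bop X Y) : opnorm (S + T) <= opnorm S + opnorm T.
Proof.
apply: opnorm_le => [|x]; first by rewrite addr_ge0 ?opnorm_ge0.
rewrite mulrDl; apply: le_trans (ler_rnormD (S x) (T x)) _.
by rewrite lerD ?le_opnorm.
Qed.

Lemma opnormZ_le (a : K) (T : bop X Y) :
  opnorm (a *: T) <= rnorm (a : K^o) * opnorm T.
Proof.
apply: opnorm_le => [|x]; first by rewrite mulr_ge0 ?opnorm_ge0 ?rnorm_ge0.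
by rewrite -mulrA -[X in rnorm X]/(a *: T x) rnormZ ler_wpM2l ?rnorm_ge0 ?le_opnorm.
Qed.

Lemma opnorm0_eq0 (T : bop X Y) : opnorm T = 0 -> T = 0.
Proof.
move=> T0; apply: val_inj; apply/funext => x /=.
apply: rnorm0_eq0; apply/eqP; rewrite eq_le rnorm_ge0 andbT.
by rewrite (le_trans (le_opnorm T x))// T0 mul0r.
Qed.

Lemma opnormZ (a : K) (T : bop X Y) :
  opnorm (a *: T) = rnorm (a : K^o) * opnorm T.
Proof.
apply/eqP; rewrite eq_le opnormZ_le /=.
have [->|a0] := eqVneq a 0.
  by rewrite /rnorm normr0 -(ofR0 _ k) re_ofR mul0r opnorm_ge0.
have := opnormZ_le a^-1 (a *: T); rewrite scalerA mulVf// scale1r.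
have agt0 : 0 < rnorm (a : K^o).
  rewrite lt_neqAle rnorm_ge0 andbT eq_sym.
  by apply: contra a0 => /eqP/rnorm0_eq0 ->.
have -> : rnorm (a^-1 : K^o) = (rnorm (a : K^o))^-1.
  apply: (mulfI (lt0r_neq0 agt0)); rewrite divff ?lt0r_neq0// -rnormZ.
  by rewrite /GRing.scale /= divff// /rnorm normr1 -(ofR1 _ k) re_ofR.
by rewrite ler_pdivlMl.
Qed.

Let ler_bnormD (S T : bop X Y) :
  ofR k (opnorm (S + T)) <= ofR k (opnorm S) + ofR k (opnorm T).
Proof. by rewrite -ofRD ofR_le ler_opnormD. Qed.

Let bnormZ (a : K) (T : bop X Y) :
  ofR k (opnorm (a *: T)) = `|a| * ofR k (opnorm T).
Proof. by rewrite opnormZ ofRM ofR_rnorm. Qed.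

Let bnorm0_eq0 (T : bop X Y) : ofR k (opnorm T) = 0 -> T = 0.
Proof. by move=> /(congr1 (@re R k)); rewrite -(ofR0 _ k) !re_ofR => /opnorm0_eq0. Qed.

HB.instance Definition _ := Lmodule_isNormed.Build K (bop X Y)
  ler_bnormD bnormZ bnorm0_eq0.

Lemma rnorm_bop (T : bop X Y) : rnorm T = opnorm T.
Proof. exact: re_ofR. Qed.

End Structure.

Section Completeness.
Variables (X : normedModType K) (Y : completeNormedModType K).

Lemma bop_cauchy_cvg (F : set_system (bop X Y)) :
  ProperFilter F -> cauchy F -> cvg F.
Proof.
move=> FF Fc.
have Fce (e : R) : 0 < e ->
    exists2 A, F A & forall S T, A S -> A T -> opnorm (S - T) <= e.
  move=> e0; have eK : 0 < ofR k e by rewrite ofR_gt0.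
  move/cauchyP : Fc => /(_ (ofR k (e / 2))) []; first by rewrite ofR_gt0 divr_gt0.
  move=> T0 FT0; exists (ball T0 (ofR k (e / 2))) => // S T.
  rewrite -!ball_normE /= => T0S T0T.
  rewrite -(ofR_le k) -rnorm_bop ofR_rnorm [e in leRHS]splitr ofRD.
  have -> : S - T = (T0 - T) - (T0 - S) by rewrite opprB [RHS]addrC subrKA.
  by apply: le_trans (ler_normB _ _) _; rewrite lerD// ltW.
have ev_cauchy (x : X) : cauchy ((fun T : bop X Y => T x) @ F).
  apply/cauchy_ballP => e e0.
  have e'0 : 0 < re e by rewrite -(ofR_gt0 k) ofR_re// ltW.
  pose d := re e / 2 / (rnorm x + 1).
  have x1 : 0 < rnorm x + 1 by rewrite ltr_wpDl ?rnorm_ge0.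
  have d0 : 0 < d by rewrite !divr_gt0.
  have [A FA Ae] := Fce d d0.
  exists ((fun T : bop X Y => T x) @` A, (fun T : bop X Y => T x) @` A) => /=.
    by split; apply: (@filterS _ F _ A) => // T AT /=; exists T.
  move=> [_ _] /= [[S AS <-] [T AT <-]]; rewrite -ball_normE /=.
  rewrite -ofR_rnorm -(ofR_re (ltW e0)) ofR_lt.
  apply: le_lt_trans (le_opnorm (S - T) x) _.
  apply: le_lt_trans (ler_wpM2r (rnorm_ge0 _) (Ae _ _ AS AT)) _.
  rewrite /d mulrAC ltr_pdivrMr// mulrC.
  apply: (@le_lt_trans _ _ ((rnorm x + 1) * (re e / 2))).
    by rewrite ler_wpM2r ?lerDl// ltW// divr_gt0.
  by rewrite mulrC ltr_pM2r// ltr_pdivrMr// ltr_pMr// ltr1n.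
pose g (x : X) : Y := lim ((fun T : bop X Y => T x) @ F).
have Fg x : (fun T : bop X Y => T x) @ F --> g x by exact: cauchy_cvg.
have g_lin : linear g.
  move=> a u v; apply: (@cvg_lim _ _ _ F) => //.
  have -> : (fun T : bop X Y => T (a *: u + v)) =
            (fun T : bop X Y => a *: T u + T v).
    by apply/funext => T; rewrite linearP.
  by apply: cvgD; [apply: cvgZr|]; exact: Fg.
have close (e : R) A T : 0 < e -> F A ->
    (forall S T, A S -> A T -> opnorm (S - T) <= e) -> A T ->
    forall x, rnorm (g x - T x) <= e * rnorm x.
  move=> e0 FA Ae AT x.
  apply/ler_addgt0Pr => d d0.
  have dK : 0 < ofR k d by rewrite ofR_gt0.
  have /cvgrPdist_lt /(_ _ dK) gxd := Fg x.
  have [S [/= gS AS]] := filter_ex (filterI gxd FA).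
  have -> : g x - T x = (S x - T x) + (g x - S x) by rewrite [RHS]addrC subrKA.
  apply: le_trans (ler_rnormD _ _) _; rewrite lerD//.
    apply: le_trans (le_opnorm (S - T) x) _.
    by rewrite ler_wpM2r ?rnorm_ge0// Ae.
  by rewrite -(ofR_le k) ofR_rnorm ltW.
have g_bop : g \in @bounded_linear X Y.
  apply/bounded_linearP; split=> //.
  have [A FA Ae] := Fce 1 ltr01; have [T AT] := filter_ex FA.
  exists (1 + opnorm T) => x; rewrite -(subrK (T x) (g x)) mulrDl.
  apply: le_trans (ler_rnormD _ _) _; rewrite lerD ?le_opnorm//.
  exact: close FA Ae AT x.
apply/cvg_ex; exists (Bop g_bop); apply/cvgrPdist_le => e e0.
have e'0 : 0 < re e by rewrite -(ofR_gt0 k) ofR_re// ltW.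
have [A FA Ae] := Fce _ e'0.
apply: (filterS _ FA) => T AT.
rewrite -(ofR_re (ltW e0)) -ofR_rnorm ofR_le rnorm_bop.
apply: opnorm_le; first exact: ltW.
exact: close e'0 FA Ae AT.
Qed.

HB.instance Definition _ := Uniform_isComplete.Build (bop X Y) bop_cauchy_cvg.

End Completeness.

Lemma id_subproof (X : normedModType K) :
  (fun x : X => x) \in @bounded_linear X X.
Proof.
by apply/bounded_linearP; split=> //; exists 1 => x; rewrite mul1r.
Qed.

Definition id_op (X : normedModType K) : bop X X := Bop (id_subproof X).

Lemma comp_subproof (X Y Z : normedModType K) (S : bop Y Z) (T : bop X Y) :
  (fun x => S (T x)) \in @bounded_linear X Z.
Proof.
apply/bounded_linearP; split=> [a u v|]; first by rewrite !linearP.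
exists (opnorm S * opnorm T) => x; apply: le_trans (le_opnorm _ _) _.
by rewrite -mulrA ler_wpM2l ?opnorm_ge0 ?le_opnorm.
Qed.

Definition comp_op (X Y Z : normedModType K) (S : bop Y Z) (T : bop X Y) :
  bop X Z := Bop (comp_subproof S T).

Definition dual_space (X : normedModType K) : completeNormedModType K :=
  bop X (scalar_space R k).

Lemma adjoint_subproof (X Y : normedModType K) (T : bop X Y) :
  (fun f : dual_space Y => comp_op f T : dual_space X) \in @bounded_linear (dual_space Y) (dual_space X).
Proof.
apply/bounded_linearP; split=> [a f g|].
  by apply: val_inj; apply/funext => x.
exists (opnorm T) => f; rewrite !rnorm_bop.
apply: opnorm_le => [|x]; first by rewrite mulr_ge0 ?opnorm_ge0.
apply: le_trans (le_opnorm f (T x)) _.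
by rewrite (mulrC (opnorm T)) -mulrA ler_wpM2l ?opnorm_ge0 ?le_opnorm.
Qed.

Definition adjoint (X Y : normedModType K) (T : bop X Y) :
  bop (dual_space Y) (dual_space X) := Bop (adjoint_subproof T).

Definition finite_rank (X Y : normedModType K) (T : bop X Y) : Prop :=
  exists (n : nat) (y : 'I_n -> Y),
    forall x, exists c : 'I_n -> K, T x = \sum_(i < n) c i *: y i.

(* Q maps the open unit ball of Z onto the open unit ball of X. *)
Definition metric_surjection (Z X : normedModType K) (Q : bop Z X) : Prop :=
  [set Q z | z in [set z : Z | `|z| < 1]] = [set x : X | `|x| < 1].

End BoundedOperators.

Section OperatorIdeals.
Variables (R : realType) (k : scalar_kind).
Local Notation K := (scalar_field R k).
Local Notation banach := (completeNormedModType K).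

Definition op_class := forall X Y : banach, set (bop X Y).

Definition op_class_le (A B : op_class) : Prop :=
  forall X Y : banach, A X Y `<=` B X Y.

Record operator_ideal (A : op_class) : Prop := {
  ideal_finite_rank : forall (X Y : banach) (T : bop X Y),
    finite_rank T -> A X Y T;
  ideal_add : forall (X Y : banach) (S T : bop X Y),
    A X Y S -> A X Y T -> A X Y (S + T);
  ideal_scale : forall (X Y : banach) (a : K) (T : bop X Y),
    A X Y T -> A X Y (a *: T);
  ideal_comp : forall (W X Y Z : banach) (U : bop Y Z) (T : bop X Y)
      (V : bop W X),
    A X Y T -> A W Z (comp_op U (comp_op T V))
}.

(* Total on bounded operators; for the norm of an ideal only the values on
   members of the ideal are constrained. *)
Definition op_norm := forall X Y : banach, bop X Y -> R.

Record banach_operator_ideal (A : op_class) (N : op_norm) : Prop := {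
  banach_ideal_ideal : operator_ideal A;
  banach_ideal_normD : forall (X Y : banach) (S T : bop X Y),
    A X Y S -> A X Y T -> N X Y (S + T) <= N X Y S + N X Y T;
  banach_ideal_normZ : forall (X Y : banach) (a : K) (T : bop X Y),
    A X Y T -> N X Y (a *: T) = re `|a| * N X Y T;
  banach_ideal_norm_eq0 : forall (X Y : banach) (T : bop X Y),
    A X Y T -> N X Y T = 0 -> T = 0;
  banach_ideal_norm_id :
    N (scalar_space R k) (scalar_space R k) (id_op (scalar_space R k)) = 1;
  banach_ideal_norm_comp : forall (W X Y Z : banach) (U : bop Y Z)
      (T : bop X Y) (V : bop W X),
    A X Y T ->
    N W Z (comp_op U (comp_op T V)) <= opnorm U * N X Y T * opnorm V;
  banach_ideal_complete : forall (X Y : banach) (T : nat -> bop X Y),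
    (forall n, A X Y (T n)) ->
    (forall e : R, 0 < e -> exists n0 : nat, forall m n : nat,
      (n0 <= m)%N -> (n0 <= n)%N -> N X Y (T m - T n) < e) ->
    exists2 S : bop X Y, A X Y S & N X Y (T n - S) @[n --> \oo] --> 0
}.

Definition usual_norm : op_norm := fun X Y => @opnorm R k X Y.

Definition closed_ideal (A : op_class) : Prop :=
  banach_operator_ideal A usual_norm.

Definition surjective_ideal (A : op_class) : Prop :=
  forall (Z X Y : banach) (Q : bop Z X) (T : bop X Y),
    metric_surjection Q -> A Z Y (comp_op T Q) -> A X Y T.

Definition dual_ideal (A : op_class) : op_class :=
  fun X Y => [set T | A (dual_space Y) (dual_space X) (adjoint T)].

Definition has_AP (A : op_class) (N : op_norm) (E : banach) : Prop :=
  forall (Y : banach) (T : bop Y E), A Y E T ->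
    forall e : R, 0 < e ->
      exists2 S : bop Y E, finite_rank S & N Y E (T - S) < e.

End OperatorIdeals.

Section Nets.
Variables (I : Type) (le : I -> I -> Prop).

Record directed : Prop := {
  directed_inhabited : inhabited I;
  directed_refl : forall i, le i i;
  directed_trans : forall i j l, le i j -> le j l -> le i l;
  directed_ub : forall i j, exists l, le i l /\ le j l
}.

Definition net_filter : set_system I :=
  filter_from setT (fun i => [set j | le i j]).

Definition net_limsup (R : realType) (u : I -> \bar R) : \bar R :=
  ereal_inf [set ereal_sup [set u j | j in [set j | le i j]] | i in setT].

End Nets.

Definition has_MAP (R : realType) (k : scalar_kind) (B : op_class R k)
    (N : op_norm R k) (X : completeNormedModType (scalar_field R k)) : Prop :=
  forall (Y : completeNormedModType (scalar_field R k)) (T : bop X Y), B X Y T ->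
    exists (I : Type) (le : I -> I -> Prop) (S : I -> bop X X),
      [/\ directed le,
          (forall i, finite_rank (S i)),
          {family compact,
            (fun i => bop_fun (S i)) @ net_filter le --> bop_fun (id_op X)} &
          (net_limsup le (fun i => (N X Y (comp_op T (S i)))%:E)
            <= (N X Y T)%:E)%E].

(* Main.v *)
From HB Require Import structures.
Require Import Defs.
From mathcomp Require Import all_boot all_order all_algebra.
From mathcomp Require Import complex ring lra.
From mathcomp Require Import all_classical all_reals all_analysis.

Set Implicit Arguments.
Unset Strict Implicit.
Unset Printing Implicit Defensive.

Import Order.TTheory GRing.Theory Num.Theory.
Import numFieldNormedType.Exports.

Local Open Scope classical_set_scope.
Local Open Scope ring_scope.

(** Write X' for the dual of X and T' for the adjoint of T.

    The approximation property of X' with respect to A is used through its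
    trace form, [trace_well_defined]: if g_n tends to 0 in X' and the
    functionals zeta_n in X'' have summable norms, and if the nuclear operator
    f |-> sum_n zeta_n(f) g_n of X' is zero, then its trace
    sum_n zeta_n(g_n) is zero.  Let M be the space of all bounded sequences
    (g_n(x))_n with x in X.  The adjoint J : M' -> X' of the surjection
    X -> M is injective, and it maps the n-th coordinate functional rho_n of M
    to g_n.  Composed with the restriction of functionals from the space of
    all bounded sequences to M, which is a metric surjection by the
    Hahn-Banach theorem, J is a norm limit of finite rank operators, because
    g_n tends to 0.  So J belongs to the surjective closed ideal A, and is
    approximated in norm by finite rank operators V.  Injectivity of J gives
    sum_n zeta_n(f) rho_n = 0 in M' for each f, hence
    sum_n zeta_n(V rho_n) = 0, and the trace of the given operator is the
    limit of these sums as V tends to J.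

    By duality, [simultaneous_approximation], the identity of X is then
    approximated by a finite rank S uniformly on a null sequence x_n of X
    while S' approximates the identity of X' uniformly on a null sequence f_n.
    Otherwise a bounded functional on pairs of sequences separates (x_n, f_n)
    from all pairs (S x_n, S' f_n).  On null sequences such a functional is
    given by summable y_n in X' and z_n in X''; that it vanishes for every S
    of rank one means that the nuclear operator
    h |-> sum_n (h(x_n) y_n + z_n(h) f_n) of X' is zero, while the trace of
    that operator is the nonzero value of the functional at (x_n, f_n).

    Let now T' belong to A.  As T' is a norm limit of finite rank operators,
    it maps the unit ball of Y' to a totally bounded set, and what a bounded
    operator does on a totally bounded set is controlled by its values on one
    null sequence ([totally_bounded_hull]).  Hence for C compact in X there is
    a finite rank S close to the identity on C and such that S' is close to
    the identity on the image of the unit ball by T', so that TS is close to T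
    in norm ([approximation_along]).  Letting C grow and the error tend to 0
    gives the net. *)

(** * Scalars and norms *)

Lemma ofRB (R : realType) (k : scalar_kind) (a b : R) :
  ofR k (a - b) = ofR k a - ofR k b.
Proof. by case: k => //=; rewrite rmorphB. Qed.

Section Norms.
Variables (R : realType) (k : scalar_kind).
Local Notation K := (scalar_field R k).

Lemma rnorm0 (V : normedZmodType K) : rnorm (0 : V) = 0.
Proof. by rewrite /rnorm normr0 -(ofR0 _ k) re_ofR. Qed.

Lemma rnormN (V : normedZmodType K) (x : V) : rnorm (- x) = rnorm x.
Proof. by rewrite /rnorm normrN. Qed.

Lemma rnorm1 : rnorm (1 : K) = 1 :> R.
Proof. by rewrite /rnorm normr1 -(ofR1 _ k) re_ofR. Qed.

Lemma rnormM (a b : K) : rnorm (a * b) = rnorm a * rnorm b :> R.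
Proof. by rewrite -[LHS](re_ofR k) ofR_rnorm normrM -!ofR_rnorm -ofRM re_ofR. Qed.

Lemma rnormV (a : K) : rnorm a^-1 = (rnorm a)^-1 :> R.
Proof.
have [->|a0] := eqVneq a 0; first by rewrite invr0 rnorm0 invr0.
have ra0 : rnorm a != 0 :> R by apply: contra_neq a0 => /rnorm0_eq0.
by apply: (mulfI ra0); rewrite -rnormM !divff// rnorm1.
Qed.

Lemma rnorm_ofR (t : R) : rnorm (ofR k t) = `|t| :> R.
Proof.
have [t0|t0] := leP 0 t.
  by rewrite /rnorm !ger0_norm ?re_ofR// -(ofR0 _ k) ofR_le.
have nE : - ofR k t = ofR k (- t).
  by rewrite -[- t]sub0r ofRB ofR0 sub0r.
rewrite ltr0_norm // -rnormN nE /rnorm ger0_norm ?re_ofR//.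
by rewrite -(ofR0 _ k) ofR_le oppr_ge0 ltW.
Qed.

Lemma linear_map0 (V W : lmodType K) (F : V -> W) : linear F -> F 0 = 0.
Proof. by move=> /(_ (-1) 0 0); rewrite scaler0 addr0 scaleN1r addNr. Qed.

Lemma linear_mapZ (V W : lmodType K) (F : V -> W) a x :
  linear F -> F (a *: x) = a *: F x.
Proof. by move=> Fl; have := Fl a x 0; rewrite (linear_map0 Fl) !addr0. Qed.

Lemma linear_mapD (V W : lmodType K) (F : V -> W) x y :
  linear F -> F (x + y) = F x + F y.
Proof. by move=> Fl; have := Fl 1 x y; rewrite !scale1r. Qed.

End Norms.

(** * The Hahn-Banach theorem over the real or complex scalars *)

Section RealHahnBanach.
Variables (R : realType) (k : scalar_kind).
Local Notation K := (scalar_field R k).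
Variables (V : lmodType K) (p : V -> R).
Hypothesis pD : forall x y, p (x + y) <= p x + p y.
Hypothesis pZ : forall (t : R) x, 0 <= t -> p (ofR k t *: x) = t * p x.

(** Partial real-linear functionals are represented by their graphs, so that
    Zorn's lemma applies to inclusion of sets; domination by p makes such a
    graph single-valued. *)
Definition real_linear_graph (G : set (V * R)) : Prop :=
  G (0, 0) /\ forall t x y a b, G (x, a) -> G (y, b) ->
    G (ofR k t *: x + y, t * a + b).

Definition dominated_graph (G : set (V * R)) : Prop :=
  forall x a, G (x, a) -> a <= p x.

Lemma ofRZ0 (x : V) : ofR k (0 : R) *: x = 0.
Proof. by rewrite ofR0 scale0r. Qed.

Lemma ofRZ1 (x : V) : ofR k (1 : R) *: x = x.
Proof. by rewrite ofR1 scale1r. Qed.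

Lemma ofRZN1 (x : V) : ofR k (-1 : R) *: x = - x.
Proof. by rewrite -[(-1 : R)]sub0r ofRB ofR0 ofR1 sub0r scaleN1r. Qed.

(** The value c at the new vector x0 must satisfy
    a - p (y - x0) <= c <= p (z + x0) - b for all (y, a) and (z, b) in the
    graph; subadditivity of p shows that each lower bound is below each upper
    bound, so the supremum of the lower bounds works. *)
Lemma graph_extension_value (G : set (V * R)) (x0 : V) :
  real_linear_graph G -> dominated_graph G ->
  exists c : R, forall y a, G (y, a) -> a + c <= p (y + x0) /\ a - c <= p (y - x0).
Proof.
move=> [G0 Glin] Gdom.
pose L := [set u.2 - p (u.1 - x0) | u in G].
have ubL y a : G (y, a) -> ubound L (p (y + x0) - a).
  move=> Gya _ [[z b] /= Gzb <-].
  have := Gdom _ _ (Glin 1 _ _ _ _ Gya Gzb); rewrite ofRZ1 mul1r.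
  have := pD (y + x0) (z - x0); rewrite addrACA subrr addr0; lra.
have L0 : has_sup L.
  split; first by exists (0 - p (0 - x0)), (0, 0).
  by exists (p (0 + x0) - 0); exact: ubL.
exists (sup L) => y a Gya; split.
- have := ge_sup L0.1 (ubL _ _ Gya); lra.
- have : a - p (y - x0) <= sup L by apply: (sup_upper_bound L0); exists (y, a).
  lra.
Qed.

Definition extended_graph (G : set (V * R)) (x0 : V) (c : R) : set (V * R) :=
  [set (ya.1 + ofR k t *: x0, ya.2 + t * c) | ya in G & t in [set: R]].

Lemma extended_graph_linear G x0 c :
  real_linear_graph G -> real_linear_graph (extended_graph G x0 c).
Proof.
move=> [G0 Glin]; split.
  by exists (0, 0) => //; exists 0 => //=; rewrite ofRZ0 mul0r !addr0.
move=> t _ _ _ _ [[y a] /= Gya [s _ [<- <-]]] [[z b] /= Gzb [r _ [<- <-]]].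
exists (ofR k t *: y + z, t * a + b); first exact: Glin.
exists (t * s + r) => //=; congr pair.
  by rewrite ofRD ofRM scalerDr scalerDl scalerA addrACA.
by ring.
Qed.

Lemma extended_graph_dominated G x0 c :
  real_linear_graph G -> dominated_graph G ->
  (forall y a, G (y, a) -> a + c <= p (y + x0) /\ a - c <= p (y - x0)) ->
  dominated_graph (extended_graph G x0 c).
Proof.
move=> [G0 Glin] Gdom cP _ _ [[y a] /= Gya [t _ [<- <-]]].
have Gs s : G (ofR k s *: y, s * a).
  by have := Glin s _ _ _ _ Gya G0; rewrite !addr0.
have [t0|t0|->] := ltgtP t 0; last first.
- by rewrite mul0r ofRZ0 !addr0; exact: Gdom.
- have [+ _] := cP _ _ (Gs t^-1).
  have -> : y + ofR k t *: x0 = ofR k t *: (ofR k t^-1 *: y + x0).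
    by rewrite scalerDr scalerA -ofRM divff ?gt_eqF// ofRZ1.
  rewrite (pZ _ (ltW t0)) => /(ler_wpM2l (ltW t0)).
  by rewrite mulrDr mulrA divff ?gt_eqF// mul1r.
- have s0 : 0 < - t by rewrite oppr_gt0.
  have [_ +] := cP _ _ (Gs (- t)^-1).
  have -> : y + ofR k t *: x0 = ofR k (- t) *: (ofR k (- t)^-1 *: y - x0).
    rewrite scalerBr scalerA -ofRM divff ?gt_eqF// ofRZ1.
    by rewrite -[- t]sub0r ofRB ofR0 sub0r scaleNr opprK.
  rewrite (pZ _ (ltW s0)) => /(ler_wpM2l (ltW s0)).
  by rewrite mulrBr mulrA divff ?gt_eqF// mul1r mulNr opprK.
Qed.

Lemma real_hahn_banach (G : set (V * R)) :
  real_linear_graph G -> dominated_graph G ->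
  exists g : V -> R, [/\ forall t x y, g (ofR k t *: x + y) = t * g x + g y,
    forall x, g x <= p x & forall x a, G (x, a) -> g x = a].
Proof.
move=> Glin Gdom.
(* G is joined to H so that the empty chain also has an upper bound in P *)
pose P := [set H : set (V * R) |
  real_linear_graph (G `|` H) /\ dominated_graph (G `|` H)].
have PU (F : set (set (V * R))) : F `<=` P -> total_on F subset ->
    P (\bigcup_(X in F) X).
  move=> FP Ftot.
  have Upick u : (G `|` \bigcup_(X in F) X) u ->
      exists H, [/\ H = set0 \/ F H, (G `|` H) u, P H & H `<=` \bigcup_(X in F) X].
    case=> [Gu|[H FH Hu]].
      exists set0; split; [by left|by left| |exact: sub0set].
      by rewrite /P/= setU0.
    by exists H; split; [right|right|exact: FP|move=> v Hv; exists H].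
  split.
    split=> [|t x y a b /Upick[H [FH Hu PH HU]] /Upick[I [FI Iu PI IU]]].
      by left; exact: Glin.1.
    have mono J : J `<=` \bigcup_(X in F) X ->
        G `|` J `<=` G `|` \bigcup_(X in F) X.
      by move=> JU u [?|/JU ?]; [left|right].
    have [HI|IH] : H `<=` I \/ I `<=` H.
      case: FH => [->|FH]; first by left; exact: sub0set.
      case: FI => [->|FI]; first by right; exact: sub0set.
      exact: Ftot.
    + by apply: (mono _ IU); apply: PI.1.2 => //; case: Hu => [?|/HI ?]; [left|right].
    + by apply: (mono _ HU); apply: PH.1.2 => //; case: Iu => [?|/IH ?]; [left|right].
  by move=> x a /Upick[H [_ Hu [_ PH] _]]; exact: PH.
have [H [[Hlin Hdom] Hmax]] := Zorn_bigcup PU.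
have H_total x : exists a, (G `|` H) (x, a).
  apply: contrapT => /forallNP nx.
  have [c cP] := graph_extension_value x Hlin Hdom.
  have sub : G `|` H `<=` extended_graph (G `|` H) x c.
    move=> [y a] Hya; exists (y, a) => //; exists 0 => //=.
    by rewrite ofRZ0 mul0r !addr0.
  apply: (Hmax (extended_graph (G `|` H) x c)).
    rewrite properEneq; split; last by move=> u Hu; apply: sub; right.
    apply/eqP => HE; apply: (nx c); right; rewrite HE.
    by exists (0, 0); [exact: Hlin.1|exists 1 => //=; rewrite ofRZ1 mul1r !add0r].
  rewrite /P /= (_ : G `|` _ = extended_graph (G `|` H) x c); last first.
    by apply/setUidPr => u Gu; apply: sub; left.
  split; [exact: extended_graph_linear|exact: extended_graph_dominated].
have H_fun x a b : (G `|` H) (x, a) -> (G `|` H) (x, b) -> a <= b.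
  move=> Ha Hb.
  have := Hdom _ _ (Hlin.2 (-1) _ _ _ _ Hb Ha); rewrite ofRZN1 addNr.
  by have := pZ 0 (lexx 0); rewrite ofRZ0 mul0r => ->; lra.
have [g gP] := choice H_total.
exists g; split=> [t x y|x|x a Gxa].
- by apply/eqP; rewrite eq_le; apply/andP; split; apply: H_fun;
    (exact: gP || apply: Hlin.2; exact: gP).
- exact: Hdom (gP x).
- by apply/eqP; rewrite eq_le; apply/andP; split; apply: H_fun (gP x) _ || apply: H_fun _ (gP x); left.
Qed.

End RealHahnBanach.

Section HahnBanach.
Variables (R : realType) (k : scalar_kind).
Local Notation K := (scalar_field R k).

Lemma re_le_rnorm (a : K) : re a <= rnorm a.
Proof.
case: k a => /= a; first exact: ler_norm.
rewrite -lecR /rnorm/= (RRe_real (normr_real a)).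
by apply: le_trans (normc_ge_Re a); rewrite lecR ler_norm.
Qed.

Lemma re_linear t (a b : K) : re (ofR k t * a + b) = t * re a + re b.
Proof. by case: k a b => //= -[a a'] [b b'] /=; rewrite mul0r subr0. Qed.

(** A linear functional is determined by its real part g; over the complex
    numbers it is F x = g x - i g (i x), and a bound on g passes to F because
    multiplying x by a scalar of modulus one makes F x real. *)
Lemma linear_of_re (V : lmodType K) (p : V -> R) (g : V -> R)
    (pZ : forall a x, p (a *: x) = rnorm a * p x)
    (g_lin : forall t x y, g (ofR k t *: x + y) = t * g x + g y)
    (g_le : forall x, g x <= p x) :
  exists F : V -> K, [/\ linear F, forall x, re (F x) = g x &
    forall x, rnorm (F x) <= p x].
Proof.
case: k V p g pZ g_lin g_le => /= V p g pZ g_lin g_le.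
  exists g; split => // x.
  rewrite /rnorm /= ler_norml g_le andbT lerNl.
  have := g_lin (-1) x 0; have := g_lin (-1) 0 0.
  rewrite !addr0 scaler0 !scaleN1r => g0 gN.
  have := g_le (- x); have := pZ (-1) x; rewrite scaleN1r /rnorm /= normrN1.
  lra.
have gD x y : g (x + y) = g x + g y by have := g_lin 1 x y; rewrite mul1r scale1r.
have g0 : g 0 = 0 by have := gD 0 0; rewrite addr0; lra.
have gZ t x : g (t%:C%C *: x) = t * g x by have := g_lin t x 0; rewrite g0 !addr0.
have gN x : g (- x) = - g x by have := gD x (- x); rewrite subrr g0; lra.
pose F x : R[i] := Complex (g x) (- g ('i%C *: x)).
have nE (a : R[i]) : Normc.normc a = @rnorm R ComplexScalars R[i] a by [].
have aE (a : R[i]) (x : V) :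
    a *: x = (complex.Re a)%:C%C *: x + (complex.Im a)%:C%C *: ('i%C *: x).
  by rewrite scalerA -scalerDl mulrC -complexE.
have gC a x : g (a *: x) = complex.Re a * g x + complex.Im a * g ('i%C *: x).
  by rewrite aE gD !gZ.
have F_lin : linear F.
  move=> a x y; rewrite /F scalerDr !gD (scalerA 'i%C) (gC a) (gC ('i%C * a)).
  case: a => a1 a2; apply/eqP; rewrite eq_complex /= !mul0r !mul1r.
  by apply/andP; split; apply/eqP; ring.
have FZ a x : F (a *: x) = a * F x.
  have F0 : F 0 = 0 by have := F_lin (-1) 0 0; rewrite scaler0 addr0 scaleN1r addNr.
  by have := F_lin a x 0; rewrite F0 !addr0.
exists F; split=> // x.
have [->|Fx0] := eqVneq (F x) 0.
  rewrite nE rnorm0.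
  have := pZ 0 0; have := g_le 0; rewrite g0.
  have := g_le x; have := g_le (- x); rewrite gN.
  have := pZ (-1) x; rewrite scaleN1r nE rnormN rnorm1; lra.
(* this scalar of modulus one makes F (th *: x) real *)
pose th : R[i] := `|F x| / F x.
have th1 : `|th| = 1 by rewrite normrM normr_id normfV divff ?normr_eq0.
have -> : Normc.normc (F x) = g (th *: x).
  by rewrite -[g _]/(complex.Re (F (th *: x))) FZ divfK.
by apply: le_trans (g_le _) _; rewrite pZ nE /rnorm th1 /= mul1r.
Qed.

Lemma linear_re_inj (V : lmodType K) (M : set V) (f h : V -> K) :
  (forall a x, M x -> M (a *: x)) ->
  (forall a x, M x -> f (a *: x) = a * f x) ->
  (forall a x, M x -> h (a *: x) = a * h x) ->
  (forall x, M x -> re (f x) = re (h x)) -> forall x, M x -> f x = h x.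
Proof.
case: k V M f h => /= V M f h MZ fZ hZ fh x Mx; first exact: fh.
have /eqP : f x - h x = 0.
  have := fh _ (MZ 'i%C x Mx); rewrite fZ// hZ//; have := fh _ Mx.
  by case: (f x) (h x) => [a b] [c d] /=; rewrite !mul0r !mul1r !sub0r => -> /oppr_inj ->; rewrite subrr.
by rewrite subr_eq0 => /eqP.
Qed.

Lemma hahn_banach (V : lmodType K) (p : V -> R) (M : set V) (f : V -> K)
    (pD : forall x y, p (x + y) <= p x + p y)
    (pZ : forall a x, p (a *: x) = rnorm a * p x)
    (M0 : M 0) (Mlin : forall a x y, M x -> M y -> M (a *: x + y))
    (f_lin : forall a x y, M x -> M y -> f (a *: x + y) = a * f x + f y)
    (f_le : forall x, M x -> rnorm (f x) <= p x) :
  exists F : V -> K, [/\ linear F, forall x, M x -> F x = f x &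
    forall x, rnorm (F x) <= p x].
Proof.
pose G := [set (x, re (f x)) | x in M].
have pZr t x : 0 <= t -> p (ofR k t *: x) = t * p x.
  by move=> t0; rewrite pZ /rnorm ger0_norm ?re_ofR// -(ofR0 _ k) ofR_le.
have f0 : f 0 = 0.
  have := f_lin 1 0 0 M0 M0.
  by rewrite scaler0 addr0 mul1r => /eqP; rewrite addrC -subr_eq subrr eq_sym => /eqP.
have Glin : real_linear_graph G.
  split; first by exists 0 => //; rewrite f0 -(ofR0 _ k) re_ofR.
  move=> t _ _ _ _ [x Mx [<- <-]] [y My [<- <-]].
  by exists (ofR k t *: x + y); [exact: Mlin|rewrite f_lin// re_linear].
have Gdom : dominated_graph p G.
  move=> _ _ [x Mx [<- <-]]; exact: le_trans (re_le_rnorm _) (f_le _ Mx).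
have [g [g_lin g_le gG]] := real_hahn_banach pD pZr Glin Gdom.
have [F [F_lin Fg F_le]] := linear_of_re pZ g_lin g_le.
exists F; split=> //; apply: (linear_re_inj (M := M)) => [a x Mx|a x Mx|a x Mx|x Mx].
- by rewrite -[_ *: _]addr0; exact: Mlin.
- exact: linear_mapZ.
- by have := f_lin a x 0 Mx M0; rewrite f0 !addr0.
- by rewrite Fg; apply: gG; exists x.
Qed.

End HahnBanach.

Section Separation.
Variables (R : realType) (k : scalar_kind).
Local Notation K := (scalar_field R k).

Lemma seminorm_ge0 (V : lmodType K) (p : V -> R)
    (pD : forall x y, p (x + y) <= p x + p y)
    (pZ : forall a x, p (a *: x) = rnorm a * p x) x : 0 <= p x.
Proof.
have := pD x (- x); have := pZ (-1) x; have := pZ 0 0.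
rewrite scaleN1r rnormN rnorm1 scaler0 rnorm0 subrr; lra.
Qed.

(** The functional m + a v0 |-> a on the span of M and v0 is dominated by
    e^-1 p, because p (m + a v0) = |a| p (v0 + m / a) >= |a| e for a <> 0. *)
Lemma separation (V : lmodType K) (p : V -> R) (M : set V) (v0 : V) (e : R)
    (pD : forall x y, p (x + y) <= p x + p y)
    (pZ : forall a x, p (a *: x) = rnorm a * p x)
    (M0 : M 0) (Mlin : forall a x y, M x -> M y -> M (a *: x + y))
    (e0 : 0 < e) (Mfar : forall m, M m -> e <= p (v0 - m)) :
  exists F : V -> K, [/\ linear F, forall m, M m -> F m = 0, F v0 = 1 &
    forall v, rnorm (F v) <= e^-1 * p v].
Proof.
have MZ a x : M x -> M (a *: x) by move=> Mx; rewrite -[_ *: _]addr0; exact: Mlin.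
have MB x y : M x -> M y -> M (x - y).
  by move=> Mx My; rewrite addrC -scaleN1r; exact: Mlin.
have Mv0 : ~ M v0 by move=> /Mfar; rewrite subrr -(scale0r 0) pZ rnorm0 mul0r; lra.
pose f (x : V) : K := xget 0 [set a | M (x - a *: v0)].
have uniq x a b : M (x - a *: v0) -> M (x - b *: v0) -> a = b.
  move=> Ma Mb; apply: contrapT => /eqP ab; apply: Mv0.
  have := MZ (b - a)^-1 _ (MB _ _ Ma Mb).
  rewrite opprB [X in _ *: X]addrC addrA subrK -scalerBl scalerA mulVf ?scale1r//.
  by rewrite subr_eq0 eq_sym.
have fE x a : M (x - a *: v0) -> f x = a.
  by move=> Ma; apply: xget_unique => // b Mb; exact: uniq Mb Ma.
pose M' := [set x | exists a, M (x - a *: v0)].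
have fP x : M' x -> M (x - f x *: v0).
  by move=> [a Ma]; rewrite (fE _ _ Ma).
have M'lin a x y : M' x -> M' y -> M ((a *: x + y) - (a * f x + f y) *: v0).
  move=> /fP Mx /fP My; rewrite scalerDl -scalerA opprD addrACA -scalerBr.
  exact: Mlin.
have M'0 : M' 0 by exists 0; rewrite scale0r subrr.
have [] := @hahn_banach R k V (fun v => e^-1 * p v) M' f.
- by move=> x y /=; rewrite -mulrDr ler_pM2l ?invr_gt0.
- by move=> a x /=; rewrite pZ mulrCA.
- by [].
- by move=> a x y Mx My; exists (a * f x + f y); exact: M'lin.
- by move=> a x y Mx My; apply: fE; exact: M'lin.
- move=> x /fP; set a := f x => Mx.
  have [->|a0] := eqVneq a 0.
    by rewrite rnorm0 mulr_ge0 ?(seminorm_ge0 pD pZ)// invr_ge0 ltW.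
  rewrite ler_pdivlMl// mulrC.
  have := Mfar _ (MZ (- a^-1) _ Mx).
  rewrite scaleNr opprK scalerBr scalerA mulVf// scale1r addrC subrK pZ rnormV.
  by rewrite ler_pdivlMl// lt_neqAle rnorm_ge0 andbT eq_sym; apply: contra_neq a0 => /rnorm0_eq0.
- move=> F [Fl Ff Fp]; exists F; split=> // [m Mm|].
  + by rewrite Ff ?(@fE _ 0) ?scale0r ?subr0//; exists 0; rewrite scale0r subr0.
  + by rewrite Ff ?(@fE _ 1) ?scale1r ?subrr//; exists 1; rewrite scale1r subrr.
Qed.

End Separation.

(** * Operators of rank one and of finite rank *)

Section RankOne.
Variables (R : realType) (k : scalar_kind).
Local Notation K := (scalar_field R k).

Lemma ler_rnorm_sum (V : normedZmodType K) (I : Type) (r : seq I) (P : pred I)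
    (x : I -> V) :
  rnorm (\sum_(i <- r | P i) x i) <= \sum_(i <- r | P i) rnorm (x i).
Proof.
elim/big_rec2: _ => [|i y1 y2 _ h]; first by rewrite rnorm0.
by apply: le_trans (ler_rnormD _ _) _; rewrite lerD2l.
Qed.

Lemma ler_rnormB (V : normedZmodType K) (x y : V) :
  rnorm (x - y) <= rnorm x + rnorm y.
Proof. by rewrite -(rnormN y) ler_rnormD. Qed.

Lemma bopDE (X Y : normedModType K) (S T : bop X Y) x : (S + T) x = S x + T x.
Proof. by []. Qed.

Lemma bopBE (X Y : normedModType K) (S T : bop X Y) x : (S - T) x = S x - T x.
Proof. by []. Qed.

Lemma bopZE (X Y : normedModType K) a (T : bop X Y) x : (a *: T) x = a *: T x.
Proof. by []. Qed.

Lemma bop_sumE (X Y : normedModType K) (I : Type) (r : seq I) (P : pred I)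
    (T : I -> bop X Y) x :
  (\sum_(i <- r | P i) T i) x = \sum_(i <- r | P i) T i x.
Proof. by elim/big_rec2: _ => // i y1 y2 _ <-. Qed.

Lemma bop_ext (X Y : normedModType K) (S T : bop X Y) : S =1 T -> S = T.
Proof. by move=> ST; apply: val_inj; apply/funext. Qed.

Lemma opnormN (X Y : normedModType K) (T : bop X Y) : opnorm (- T) = opnorm T.
Proof. by rewrite -!rnorm_bop rnormN. Qed.

Lemma ler_opnormB (X Y : normedModType K) (S T : bop X Y) :
  opnorm (S - T) <= opnorm S + opnorm T.
Proof. by rewrite -(opnormN T) ler_opnormD. Qed.

Lemma opnorm0 (X Y : normedModType K) : opnorm (0 : bop X Y) = 0.
Proof. by rewrite -rnorm_bop rnorm0. Qed.

Lemma bounded_op_exists (X Y : normedModType K) (f : X -> Y) (M : R) :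
  linear f -> (forall x, rnorm (f x) <= M * rnorm x) ->
  exists T : bop X Y, bop_fun T = f.
Proof.
move=> fl fM; have fP : f \in @bounded_linear R k X Y.
  by apply/bounded_linearP; split=> //; exists M.
by exists (Bop fP).
Qed.

Lemma rank_one_subproof (X Y : normedModType K) (f : dual_space X) (y : Y) :
  (fun x => (f x : K) *: y) \in @bounded_linear R k X Y.
Proof.
apply/bounded_linearP; split=> [a u v|].
  by rewrite linearP scalerDl -scalerA.
exists (opnorm f * rnorm y) => x; rewrite rnormZ mulrAC.
by rewrite ler_wpM2r ?rnorm_ge0// le_opnorm.
Qed.

Definition rank_one (X Y : normedModType K) (f : dual_space X) (y : Y) : bop X Y :=
  Bop (rank_one_subproof f y).

Lemma opnorm_rank_one (X Y : normedModType K) (f : dual_space X) (y : Y) :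
  opnorm (rank_one f y) <= opnorm f * rnorm y.
Proof.
apply: opnorm_le => [|x]; first by rewrite mulr_ge0 ?opnorm_ge0 ?rnorm_ge0.
by rewrite [X in rnorm X]/= rnormZ mulrAC ler_wpM2r ?rnorm_ge0// le_opnorm.
Qed.

Lemma finite_rank_rank_one (X Y : normedModType K) (f : dual_space X) (y : Y) :
  finite_rank (rank_one f y).
Proof. by exists 1%N, (fun=> y) => x; exists (fun=> f x); rewrite big_ord1. Qed.

Lemma finite_rank0 (X Y : normedModType K) : finite_rank (0 : bop X Y).
Proof. by exists 0%N, (fun=> 0) => x; exists (fun=> 0); rewrite big_ord0. Qed.

Lemma finite_rankP (X Y : normedModType K) (a : K) (S T : bop X Y) :
  finite_rank S -> finite_rank T -> finite_rank (a *: S + T).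
Proof.
move=> [n [y Sy]] [m [z Tz]].
exists (n + m)%N,
  (fun i : 'I_(n + m) => match fintype.split i with inl j => y j | inr j => z j end) => x.
have [c Sx] := Sy x; have [d Tx] := Tz x.
exists (fun i : 'I_(n + m) =>
  match fintype.split i with inl j => a * c j | inr j => d j end).
have -> : (a *: S + T) x = a *: S x + T x by [].
rewrite Sx Tx big_split_ord /= scaler_sumr; congr (_ + _); apply: eq_bigr => i _.
  by rewrite (unsplitK (inl i)) scalerA.
by rewrite (unsplitK (inr i)).
Qed.

End RankOne.

(** * Bounded sequences as operators on finite sequences *)

(** Finite sequences under the l^1 norm, encoded by polynomials. The operators
    from this space into F are the bounded sequences in F, and their operator
    norm is the supremum norm: this realizes l^infty(F), and l^infty itself as
    a dual. *)
Definition fin_seq (R : realType) (k : scalar_kind) : Type :=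
  {poly scalar_field R k}.

HB.instance Definition _ (R : realType) (k : scalar_kind) :=
  GRing.Lmodule.copy (fin_seq R k) {poly scalar_field R k}.

Section FinSeq.
Variables (R : realType) (k : scalar_kind).
Local Notation K := (scalar_field R k).
Local Notation D := (fin_seq R k).

Lemma fin_seq_sumE (W : nmodType) (g : nat -> K -> W) (p : {poly K}) n :
  (forall i, g i 0 = 0) -> (size p <= n)%N ->
  \sum_(i < size p) g i p`_i = \sum_(i < n) g i p`_i.
Proof.
move=> g0 pn; rewrite (big_ord_widen n (fun i => g i p`_i) pn).
rewrite [RHS](bigID (fun i : 'I_n => (i < size p)%N)) /= [X in _ = _ + X]big1 ?addr0//.
by move=> i; rewrite -leqNgt => ip; rewrite nth_default.
Qed.

Definition fin_seq_norm (p : D) : K := \sum_(i < size (p : {poly K})) `|(p : {poly K})`_i|.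

Lemma fin_seq_normD (p q : D) : fin_seq_norm (p + q) <= fin_seq_norm p + fin_seq_norm q.
Proof.
rewrite /fin_seq_norm.
pose n := maxn (size ((p + q : D) : {poly K}))
  (maxn (size (p : {poly K})) (size (q : {poly K}))).
have g0 (i : nat) : `|0 : K| = 0 by rewrite normr0.
rewrite !(@fin_seq_sumE _ (fun i x => `|x|) _ n g0) ?leq_max ?leqnn ?orbT//.
by rewrite -big_split /=; apply: ler_sum => i _; rewrite coefD ler_normD.
Qed.

Lemma fin_seq_normZ (a : K) (p : D) : fin_seq_norm (a *: p) = `|a| * fin_seq_norm p.
Proof.
have g0 (i : nat) : `|0 : K| = 0 by rewrite normr0.
rewrite /fin_seq_norm (@fin_seq_sumE _ (fun i x => `|x|) _ (size (p : {poly K})) g0).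
  by rewrite mulr_sumr; apply: eq_bigr => i _; rewrite coefZ normrM.
exact: size_scale_leq.
Qed.

Lemma fin_seq_norm0_eq0 (p : D) : fin_seq_norm p = 0 -> p = 0.
Proof.
move=> /eqP; rewrite psumr_eq0// => /allP p0; apply/polyP => i; rewrite coef0.
have [ip|ip] := ltnP i (size (p : {poly K})); last by rewrite nth_default.
by have := p0 (Ordinal ip) (mem_index_enum _); rewrite /= normr_eq0 => /eqP.
Qed.

HB.instance Definition _ := Lmodule_isNormed.Build K D
  fin_seq_normD fin_seq_normZ fin_seq_norm0_eq0.

Lemma rnorm_fin_seq (p : D) :
  rnorm p = \sum_(i < size (p : {poly K})) rnorm (p : {poly K})`_i.
Proof.
rewrite -[RHS](re_ofR k) (big_morph _ (@ofRD R k) (ofR0 R k)).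
by congr re; apply: eq_bigr => i _; rewrite ofR_rnorm.
Qed.

Definition unit_seq (n : nat) : D := ('X^n : {poly K}).

Lemma rnorm_unit_seq n : rnorm (unit_seq n) = 1 :> R.
Proof.
rewrite rnorm_fin_seq size_polyXn big_ord_recr /= coefXn eqxx rnorm1.
rewrite big1 ?add0r// => i _; rewrite coefXn ltn_eqF ?rnorm0//.
Qed.

Lemma fin_seqE (p : D) : p = \sum_(i < size (p : {poly K})) (p : {poly K})`_i *: unit_seq i.
Proof. by rewrite -[LHS](coefK p) poly_def. Qed.

Lemma opnorm_fin_seq_le (F : normedModType K) (u : bop D F) (M : R) :
  0 <= M -> (forall n, rnorm (u (unit_seq n)) <= M) -> opnorm u <= M.
Proof.
move=> M0 uM; apply: opnorm_le => // p.
rewrite rnorm_fin_seq {1}(fin_seqE p) linear_sum.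
apply: le_trans (ler_rnorm_sum _ _ _) _; rewrite mulr_sumr.
by apply: ler_sum => i _; rewrite linearZ rnormZ mulrC ler_wpM2r ?rnorm_ge0 ?uM.
Qed.

Lemma le_opnorm_unit_seq (F : normedModType K) (u : bop D F) n :
  rnorm (u (unit_seq n)) <= opnorm u.
Proof. by have := le_opnorm u (unit_seq n); rewrite rnorm_unit_seq mulr1. Qed.

Lemma seq_op_exists (F : normedModType K) (u : nat -> F) (M : R) :
  (forall n, rnorm (u n) <= M) ->
  exists T : bop D F, forall n, T (unit_seq n) = u n.
Proof.
move=> uM.
pose f (p : D) : F := \sum_(i < size (p : {poly K})) (p : {poly K})`_i *: u i.
have g0 (i : nat) : 0 *: u i = 0 by rewrite scale0r.
have [|p|T Tf] := @bounded_op_exists R k D F f M.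
- move=> a p q; rewrite /f.
  pose n := maxn (size ((a *: p + q : D) : {poly K}))
    (maxn (size (p : {poly K})) (size (q : {poly K}))).
  rewrite !(@fin_seq_sumE _ (fun i x => x *: u i) _ n g0) ?leq_max ?leqnn ?orbT//.
  rewrite scaler_sumr -big_split /=; apply: eq_bigr => i _.
  by rewrite coefD coefZ scalerDl scalerA.
- rewrite rnorm_fin_seq; apply: le_trans (ler_rnorm_sum _ _ _) _; rewrite mulr_sumr.
  by apply: ler_sum => i _; rewrite rnormZ mulrC ler_wpM2r ?rnorm_ge0.
exists T => n; rewrite Tf /f size_polyXn big_ord_recr /= coefXn eqxx scale1r.
by rewrite big1 ?add0r// => i _; rewrite coefXn ltn_eqF ?scale0r.
Qed.

Lemma seq_coord_subproof n :
  (fun p : D => (p : {poly K})`_n : scalar_space R k)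
    \in @bounded_linear R k D (scalar_space R k).
Proof.
apply/bounded_linearP; split=> [a p q|]; first by rewrite coefD coefZ.
exists 1 => p; rewrite mul1r rnorm_fin_seq.
have [np|np] := ltnP n (size (p : {poly K})); last first.
  by rewrite nth_default// rnorm0 sumr_ge0// => i _; exact: rnorm_ge0.
rewrite (bigD1 (Ordinal np)) //= lerDl sumr_ge0// => i _; exact: rnorm_ge0.
Qed.

Definition seq_coord (n : nat) : dual_space D := Bop (seq_coord_subproof n).

Lemma seq_coord_unit_seq m n : seq_coord n (unit_seq m) = (n == m)%:R.
Proof. by rewrite /= coefXn. Qed.

End FinSeq.

(** * Summable and null sequences *)

(** A summable sequence stays summable after division by a suitable null
    sequence mu: the square roots of the tails r n work, since
    a n = r n - r n.+1 and (r n - r n.+1) / sqrt (r n) is at most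
    2 (sqrt (r n) - sqrt (r n.+1)), which telescopes. *)
Lemma summable_slack (R : realType) (a : nat -> R) (C : R) :
  (forall n, 0 <= a n) -> (forall N, \sum_(n < N) a n <= C) ->
  exists mu : nat -> R, [/\ forall n, 0 <= mu n,
    forall n, 0 < a n -> 0 < mu n,
    forall e, 0 < e -> exists N, forall n, (N <= n)%N -> mu n <= e &
    exists C', forall N, \sum_(n < N) a n / mu n <= C'].
Proof.
move=> a0 aC.
pose s N := \sum_(n < N) a n.
have sS N : s N.+1 = s N + a N by rewrite /s big_ord_recr.
have s_mono m n : (m <= n)%N -> s m <= s n.
  move=> /subnK <-; elim: (n - m)%N => // d IH.
  by rewrite addSn sS (le_trans IH)// lerDl.
have sup_s : has_sup (range s).
  by split; [exists (s 0%N), 0%N|exists C => _ [N _ <-]; exact: aC].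
pose r n := sup (range s) - s n.
have r0 n : 0 <= r n.
  by rewrite subr_ge0; apply: (sup_upper_bound sup_s); exists n.
have rS n : r n = a n + r n.+1 by rewrite /r sS; ring.
exists (fun n => Num.sqrt (r n)); split=> [n|n an|e e0|].
- exact: sqrtr_ge0.
- by rewrite sqrtr_gt0 rS ltr_wpDr.
- have e2 : 0 < e ^+ 2 by rewrite exprn_gt0.
  have [_ [N _ <-] sN] := sup_adherent e2 sup_s.
  exists N => n Nn; rewrite -(gtr0_norm e0) -sqrtr_sqr; apply: ler_wsqrtr.
  rewrite /r; have := s_mono _ _ Nn; lra.
exists (2 * Num.sqrt (r 0%N)) => N.
suff : \sum_(n < N) a n / Num.sqrt (r n) + 2 * Num.sqrt (r N) <= 2 * Num.sqrt (r 0%N).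
  by have := sqrtr_ge0 (r N); lra.
elim: N => [|N IH]; first by rewrite big_ord0 add0r.
rewrite big_ord_recr /=; apply: le_trans IH; rewrite -addrA lerD2l.
have aE : a N = Num.sqrt (r N) ^+ 2 - Num.sqrt (r N.+1) ^+ 2.
  by rewrite !sqr_sqrtr// [r N]rS addrK.
have := sqrtr_ge0 (r N.+1); have := sqrtr_ge0 (r N).
rewrite le_eqVlt => /orP[/eqP r0N|].
  have -> : Num.sqrt (r N.+1) = 0.
    apply/eqP; rewrite sqrtr_eq0; have := a0 N; have := rS N.
    have : r N <= 0 by rewrite -sqrtr_eq0 -r0N.
    lra.
  by rewrite -r0N invr0 mulr0 mulr0 addr0.
rewrite aE; set x := Num.sqrt (r N); set y := Num.sqrt (r N.+1) => x0 y0.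
have -> : (x ^+ 2 - y ^+ 2) / x = (x - y) * (1 + y / x).
  by field; rewrite gt_eqF.
have : y / x <= 1.
  rewrite ler_pdivrMr// mul1r ler_wsqrtr//; have := a0 N; have := rS N; lra.
have xy : 0 <= x - y.
  rewrite subr_ge0 ler_wsqrtr//; have := a0 N; have := rS N; lra.
have : 0 <= y / x by rewrite divr_ge0// ltW.
nra.
Qed.

Section Sequences.
Variables (R : realType) (k : scalar_kind).
Local Notation K := (scalar_field R k).
Local Notation D := (fin_seq R k).

Definition null_seq (F : normedZmodType K) (u : nat -> F) : Prop :=
  forall e : R, 0 < e -> exists N, forall n, (N <= n)%N -> rnorm (u n) <= e.

Definition seq_lim (F : normedZmodType K) (u : nat -> F) (l : F) : Prop :=
  null_seq (fun n => u n - l).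

(** A scalar of modulus one makes the nearly extremal value real. *)
Lemma opnorm_nearly_attained (F : normedModType K) (f : dual_space F) (d : R) :
  0 < d -> exists y : F, rnorm y <= 1 /\ exists t : R, f y = ofR k t /\ opnorm f - d <= t.
Proof.
move=> d0; have [_ [y /= y1 <-] fy] := sup_adherent d0 (opnorm_has_sup f).
have [fy0|fy0] := eqVneq (f y) 0.
  exists y; split=> //; exists 0; rewrite fy0 ofR0; split=> //.
  by move: fy; rewrite fy0 rnorm0 => /ltW.
pose th : K := ofR k (rnorm (f y)) / f y.
have fyn : rnorm (f y) != 0 by apply: contra_neq fy0 => /rnorm0_eq0.
exists (th *: y); split.
  by rewrite rnormZ /th rnormM rnormV rnorm_ofR ger0_norm ?rnorm_ge0// divff// mul1r.
exists (rnorm (f y)); split; last exact: ltW.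
by rewrite linearZ /= /GRing.scale /= divfK.
Qed.

(** A bounded functional on l^infty(F) restricts on the null sequences to a
    summable family of functionals on F.  Testing it on sequences with finitely
    many nonzero terms, each nearly norming the corresponding functional,
    bounds the sum of the norms; a null sequence is the norm limit of its
    truncations. *)
Lemma coordinate_functionals (F : normedModType K) (phi : bop D F -> K) (C : R) :
  0 <= C -> linear phi -> (forall u, rnorm (phi u) <= C * opnorm u) ->
  exists y : nat -> dual_space F, (forall N, \sum_(n < N) opnorm (y n) <= C) /\
    forall u : bop D F, null_seq (fun n => u (unit_seq R k n)) ->
      seq_lim (fun N => \sum_(n < N) (y n (u (unit_seq R k n)) : K)) (phi u).
Proof.
move=> C0 phil phiC.
have rank_one_lin n : linear (fun v : F => rank_one (seq_coord R k n) v).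
  by move=> a v w; apply: bop_ext => p; rewrite bopDE bopZE /= scalerDr !scalerA mulrC.
have ex n : exists y : dual_space F, forall v, y v = phi (rank_one (seq_coord R k n) v).
  have [|v|y yE] := @bounded_op_exists R k F (scalar_space R k)
      (fun v => phi (rank_one (seq_coord R k n) v)) (C * opnorm (seq_coord R k n)).
  - by move=> a v w; rewrite rank_one_lin phil.
  - apply: le_trans (phiC _) _; rewrite -mulrA ler_wpM2l// opnorm_rank_one//.
  - by exists y => v; rewrite yE.
have [y yE] := choice ex; exists y.
have phi_sum N (v : nat -> F) :
    \sum_(n < N) (y n (v n) : K) = phi (\sum_(n < N) rank_one (seq_coord R k n) (v n)).
  rewrite (big_morph phi (id1 := 0) (op1 := +%R)); first by apply: eq_bigr => n _; rewrite yE.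
    by move=> u w; apply: linear_mapD.
  exact: linear_map0.
have sumE N (v : nat -> F) m :
    (\sum_(n < N) rank_one (seq_coord R k n) (v n)) (unit_seq R k m) =
    if (m < N)%N then v m else 0.
  rewrite bop_sumE; case: ltnP => mN.
    rewrite (bigD1 (Ordinal mN)) //= coefXn eqxx scale1r big1 ?addr0// => i im.
    by rewrite coefXn -[(_ == _)%N]/(i == Ordinal mN) (negbTE im) scale0r.
  rewrite big1// => i _; rewrite /= coefXn ltn_eqF ?scale0r//.
  exact: leq_trans (ltn_ord i) mN.
split=> [N|u u0 e e0].
  apply/ler_addgt0Pr => e e0.
  have d0 : 0 < e / N.+1%:R by rewrite divr_gt0.
  have [v vP] := choice (fun n => opnorm_nearly_attained (y n) d0).
  have [t tP] := choice (fun n => (vP n).2).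
  apply: (@le_trans _ _ (\sum_(n < N) (t n + e / N.+1%:R))).
    by apply: ler_sum => n _; rewrite -lerBlDr (tP n).2.
  rewrite big_split /= sumr_const card_ord lerD//.
    apply: le_trans (ler_norm _) _; rewrite -(rnorm_ofR k).
    rewrite (big_morph _ (@ofRD R k) (ofR0 R k)).
    rewrite (eq_bigr (fun n : 'I_N => y n (v n) : K)); last first.
      by move=> n _; rewrite (tP n).1.
    rewrite phi_sum; apply: le_trans (phiC _) _; rewrite -[leRHS]mulr1 ler_wpM2l//.
    apply: opnorm_fin_seq_le => // m; rewrite sumE; case: ifP => _.
      exact: (vP m).1.
    by rewrite rnorm0.
  by rewrite -[leLHS]mulr_natr mulrAC ler_pdivrMr// ler_pM2l// ler_nat.
have e'0 : 0 < e / (C + 1) by rewrite divr_gt0// ltr_wpDl.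
have [N0 uN0] := u0 _ e'0; exists N0 => N NN0.
rewrite (phi_sum N (fun n => u (unit_seq R k n))).
have -> (a b : bop D F) : phi a - phi b = phi (a - b).
  by rewrite [a - b]addrC -[- b]scaleN1r phil scaleN1r addrC.
apply: le_trans (phiC _) _.
apply: (@le_trans _ _ (C * (e / (C + 1)))).
  rewrite ler_wpM2l//; apply: opnorm_fin_seq_le; first exact: ltW.
  move=> m; rewrite bopBE (sumE N (fun n => u (unit_seq R k n))) /=.
  case: ltnP => mN; first by rewrite subrr rnorm0 ltW.
  by rewrite sub0r rnormN uN0// (leq_trans NN0).
by rewrite mulrA ler_pdivrMr ?ltr_wpDl// mulrC ler_pM2l// lerDl ler01.
Qed.

End Sequences.

(** * Finite rank operators into a dual *)

Section FiniteRankDual.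
Variables (R : realType) (k : scalar_kind).
Local Notation K := (scalar_field R k).
Variable X : normedModType K.

(** The finite rank operator sum_j a_j (x) k_j of X' for s = (a_j, k_j)_j. *)
Definition interpolate (s : seq (X * dual_space X)) (f : dual_space X) : dual_space X :=
  \sum_(j <- s) (f j.1 : K) *: j.2.

Lemma interpolate_linear s : linear (interpolate s).
Proof.
move=> a f g; rewrite /interpolate scaler_sumr -big_split /=.
by apply: eq_bigr => j _; rewrite scalerA -scalerDl.
Qed.

(** In a dual the functionals of a finite rank projection can be taken to be
    evaluations at points of X, since these separate X'.  One more functional
    h n is reproduced by adding the pair (a, d), where d is the error at h n
    and a is chosen so that f a is proportional to the error of f at x. *)
Lemma interpolation (h : nat -> dual_space X) n :
  exists s, forall i, (i < n)%N -> h i = interpolate s (h i).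
Proof.
elim: n => [|n [s sP]]; first by exists [::].
pose d : dual_space X := h n - interpolate s (h n).
have [d0|d0] := pselect (forall x, d x = 0).
  exists s => i; rewrite ltnS leq_eqVlt => /orP[/eqP ->|]; last exact: sP.
  by apply/eqP; rewrite -subr_eq0; apply/eqP; apply: bop_ext => x; exact: d0.
have [x dx] : exists x, d x != 0.
  by apply: contrapT => /forallNP nx; apply: d0 => x; apply/eqP/negPn/negP/nx.
pose a := (d x)^-1 *: (x - \sum_(j <- s) (j.2 x : K) *: j.1).
have aE (f : dual_space X) : f a = (d x)^-1 * ((f - interpolate s f) x : K).
  rewrite linearZ /= linearB /= linear_sum /= ; congr (_ * (_ - _)).
  rewrite bop_sumE; apply: eq_bigr => j _; rewrite bopZE linearZ; exact: mulrC.
exists ((a, d) :: s) => i; rewrite /interpolate big_cons -/(interpolate s _) /= aE.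
rewrite ltnS leq_eqVlt => /orP[/eqP ->|/sP hi].
  by rewrite mulVf// scale1r subrK.
by rewrite -hi subrr mulr0 scale0r add0r.
Qed.

Lemma finite_rank_interpolate (Z : normedModType K) (V : bop Z (dual_space X)) :
  finite_rank V -> exists s, forall z, V z = interpolate s (V z).
Proof.
move=> [n [y Vy]].
case: n y Vy => [|n] y Vy.
  by exists [::] => z; have [c ->] := Vy z; rewrite big_ord0 /interpolate big_nil.
have [s sP] := interpolation (fun i => y (inord i)) n.+1.
exists s => z; have [c ->] := Vy z.
rewrite (big_morph (interpolate s) (id1 := 0) (op1 := +%R)).
- apply: eq_bigr => i _; rewrite (linear_mapZ _ _ (@interpolate_linear s)); congr (_ *: _).
  by have := sP i (ltn_ord i); rewrite inord_val.
- by move=> f g; apply: linear_mapD; exact: interpolate_linear.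
- exact/linear_map0/interpolate_linear.
Qed.

End FiniteRankDual.

(** * Calculus of null sequences *)

Section NullSequences.
Variables (R : realType) (k : scalar_kind).
Local Notation K := (scalar_field R k).

Lemma null_seq0 (F : normedZmodType K) : null_seq (fun _ : nat => 0 : F).
Proof. by move=> e e0; exists 0%N => n _; rewrite rnorm0 ltW. Qed.

Lemma null_seqD (F : normedZmodType K) (u v : nat -> F) :
  null_seq u -> null_seq v -> null_seq (fun n => u n + v n).
Proof.
move=> u0 v0 e e0; have e2 : 0 < e / 2 by rewrite divr_gt0.
have [N uN] := u0 _ e2; have [N' vN] := v0 _ e2.
exists (maxn N N') => n; rewrite geq_max => /andP[Nn N'n].
by rewrite [e]splitr (le_trans (ler_rnormD _ _))// lerD// ?uN ?vN.
Qed.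

Lemma null_seq_le (F G : normedZmodType K) (u : nat -> F) (v : nat -> G) (c : R) :
  (forall n, rnorm (u n) <= c * rnorm (v n)) -> null_seq v -> null_seq u.
Proof.
move=> uv v0 e e0; have c0 : 0 < `|c| + 1 by rewrite ltr_wpDl.
have [N vN] := v0 (e / (`|c| + 1)) (divr_gt0 e0 c0).
exists N => n Nn; apply: le_trans (uv n) _.
apply: (@le_trans _ _ ((`|c| + 1) * rnorm (v n))).
  by rewrite ler_wpM2r ?rnorm_ge0// (le_trans (ler_norm c))// lerDl.
by rewrite -ler_pdivlMl// mulrC vN.
Qed.

Lemma null_seq_sum (F : normedZmodType K) (I : Type) (r : seq I) (u : I -> nat -> F) :
  (forall i, null_seq (u i)) -> null_seq (fun n => \sum_(i <- r) u i n).
Proof.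
move=> u0; elim: r => [|i r IH].
  apply: (@null_seq_le _ F _ (fun=> 0) 0 _ (null_seq0 F)) => n.
  by rewrite big_nil rnorm0 mulr0.
apply: (@null_seq_le _ F _ (fun n => u i n + \sum_(j <- r) u j n) 1); last exact: null_seqD.
by move=> n; rewrite big_cons mul1r.
Qed.

Lemma null_seq_bounded (F : normedZmodType K) (u : nat -> F) :
  null_seq u -> exists2 B : R, 0 <= B & forall n, rnorm (u n) <= B.
Proof.
move=> /(_ 1 ltr01)[N uN]; exists (1 + \sum_(n < N) rnorm (u n)).
  by rewrite addr_ge0// sumr_ge0// => i _; rewrite rnorm_ge0.
move=> n; have [Nn|nN] := leqP N n.
  by rewrite (le_trans (uN _ Nn))// lerDl sumr_ge0// => i _; rewrite rnorm_ge0.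
rewrite (bigD1 (Ordinal nN)) //= addrCA lerDl addr_ge0//.
by rewrite sumr_ge0// => i _; rewrite rnorm_ge0.
Qed.

End NullSequences.

(** * The range of an operator as a normed space *)

Section RangeSpace.
Variables (R : realType) (k : scalar_kind).
Local Notation K := (scalar_field R k).

Definition in_range (X P : normedModType K) (G : bop X P) : {pred P} :=
  fun u => `[< exists x, G x = u >].

Record range_space (X P : normedModType K) (G : bop X P) :=
  RangeSpace { range_val :> P; range_valP : range_val \in in_range G }.

Section Structure.
Variables (X P : normedModType K) (G : bop X P).

HB.instance Definition _ := [isSub of range_space G for @range_val X P G].
HB.instance Definition _ := [Choice of range_space G by <:].

Lemma in_range_submod_closed : submod_closed (in_range G).
Proof.
split=> [|a _ _ /asboolP[x <-] /asboolP[y <-]]; apply/asboolP.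
  by exists 0; rewrite linear0.
by exists (a *: x + y); rewrite linearP.
Qed.

HB.instance Definition _ := GRing.isSubmodClosed.Build K P (in_range G)
  in_range_submod_closed.
HB.instance Definition _ := [SubChoice_isSubLmodule of range_space G by <:].

Definition range_norm (u : range_space G) : K := `|val u|.

Lemma range_normD u v : range_norm (u + v) <= range_norm u + range_norm v.
Proof. by rewrite /range_norm raddfD ler_normD. Qed.

Lemma range_normZ a u : range_norm (a *: u) = `|a| * range_norm u.
Proof. by rewrite /range_norm linearZ normrZ. Qed.

Lemma range_norm0_eq0 u : range_norm u = 0 -> u = 0.
Proof. by move=> /normr0_eq0 u0; apply: val_inj; rewrite u0 raddf0. Qed.

HB.instance Definition _ := Lmodule_isNormed.Build K (range_space G)
  range_normD range_normZ range_norm0_eq0.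

Lemma rnorm_range (u : range_space G) : rnorm u = rnorm (val u).
Proof. by []. Qed.

Lemma range_incl_subproof : (fun u : range_space G => val u) \in @bounded_linear R k _ P.
Proof.
apply/bounded_linearP; split=> [a u v|]; first by rewrite linearP.
by exists 1 => u; rewrite mul1r rnorm_range.
Qed.

Definition range_incl : bop (range_space G) P := Bop range_incl_subproof.

Lemma corestrict_in_range x : G x \in in_range G.
Proof. by apply/asboolP; exists x. Qed.

Lemma corestrict_subproof :
  (fun x => RangeSpace (corestrict_in_range x)) \in @bounded_linear R k X (range_space G).
Proof.
apply/bounded_linearP; split=> [a u v|].
  by apply: val_inj; rewrite [RHS]linearP; exact: linearP.
by exists (opnorm G) => x; rewrite rnorm_range /= le_opnorm.
Qed.

Definition corestrict : bop X (range_space G) := Bop corestrict_subproof.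

Lemma corestrict_surj (u : range_space G) : exists x, u = corestrict x.
Proof.
by case: u => u uP; have /asboolP[x xu] := uP; exists x; apply: val_inj; rewrite /= xu.
Qed.

Lemma normr_lt1 (V : normedZmodType K) (v : V) : (`|v| < 1) = (rnorm v < 1).
Proof. by rewrite -(ofR_lt k) ofR_rnorm ofR1. Qed.

(** Each functional on the range extends to the whole space with the same
    norm. *)
Lemma restriction_metric_surjection : metric_surjection (adjoint range_incl).
Proof.
apply/seteqP; split=> f /=.
  move=> [u + <-]; rewrite !normr_lt1 !rnorm_bop; apply: le_lt_trans.
  apply: opnorm_le => [|m]; first exact: opnorm_ge0.
  exact: le_opnorm u (val m).
rewrite normr_lt1 rnorm_bop => f1.
(* f is turned into a function on P by the value f 0 outside the range *)
pose h (u : P) : K := f (insubd (0 : range_space G) u).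
have hE u : u \in in_range G -> val (insubd (0 : range_space G) u) = u.
  by move=> uG; rewrite insubdK.
have [||||||F [Fl Fh FN]] := @hahn_banach R k P (fun u => opnorm f * rnorm u)
    (fun u => u \in in_range G) h.
- by move=> x y /=; rewrite -mulrDr ler_wpM2l ?opnorm_ge0 ?ler_rnormD.
- by move=> a x /=; rewrite rnormZ mulrCA.
- exact: rpred0.
- by move=> a x y xG yG; rewrite rpredD ?rpredZ.
- move=> a x y xG yG; rewrite /h.
  have sG : a *: x + y \in in_range G by rewrite rpredD ?rpredZ.
  rewrite (_ : insubd _ (a *: x + y) = a *: insubd (0 : range_space G) x + insubd (0 : range_space G) y).
    by rewrite linearP.
  by apply: val_inj; rewrite (hE _ sG) [RHS]linearP /= (hE _ xG) (hE _ yG).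
- by move=> u uG; rewrite /h -[in leRHS](hE _ uG) -rnorm_range le_opnorm.
have [Fb FbE] := bounded_op_exists (Y := scalar_space R k) Fl FN.
exists Fb; last first.
  apply: bop_ext => m /=; rewrite FbE Fh ?range_valP// /h.
  by congr (f _); apply: val_inj; rewrite insubdK ?range_valP.
rewrite normr_lt1 rnorm_bop; apply: le_lt_trans f1.
by apply: opnorm_le => [|u]; rewrite ?opnorm_ge0// FbE.
Qed.

End Structure.
End RangeSpace.

(** * The trace of a nuclear operator on a dual space *)

Section TraceLemma.
Variables (R : realType) (k : scalar_kind).
Local Notation K := (scalar_field R k).
Local Notation D := (fin_seq R k).
Local Notation banach := (completeNormedModType K).

(** Completeness of the ideal in the operator norm yields a limit in A; it is
    T by uniqueness of limits. *)
Lemma closed_ideal_limit (A : op_class R k) (X Y : banach)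
    (B : nat -> bop X Y) (T : bop X Y) :
  closed_ideal A -> (forall n, A X Y (B n)) -> seq_lim B T -> A X Y T.
Proof.
move=> Acl AB BT.
have [|S AS BS] := banach_ideal_complete Acl AB.
  move=> e e0; have e4 : 0 < e / 4 by rewrite divr_gt0.
  have [N NP] := BT _ e4; exists N => m n Nm Nn; rewrite /usual_norm.
  have -> : B m - B n = (B m - T) - (B n - T) by rewrite opprB addrA subrK.
  apply: le_lt_trans (ler_opnormB _ _) _.
  have := NP _ Nm; have := NP _ Nn; rewrite !rnorm_bop; lra.
suff -> : T = S by [].
apply/eqP; rewrite -subr_eq0; apply/eqP/opnorm0_eq0/eqP.
rewrite eq_le opnorm_ge0 andbT; apply/ler_addgt0Pr => e e0.
have e2 : 0 < e / 2 by rewrite divr_gt0.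
have [N NP] := BT _ e2.
move/cvgrPdist_le : BS => /(_ _ e2) [N' _ N'P].
pose n := maxn N N'.
have -> : T - S = (B n - S) - (B n - T) by rewrite opprB [RHS]addrC addrA subrK.
apply: le_trans (ler_opnormB _ _) _; rewrite add0r [e]splitr lerD//.
  have := N'P n (leq_maxr _ _); rewrite /= sub0r normrN /usual_norm.
  by rewrite ger0_norm ?opnorm_ge0.
by have := NP n (leq_maxl _ _); rewrite rnorm_bop.
Qed.

Lemma evaluation_subproof (X : normedModType K) (x : X) :
  (fun f : dual_space X => f x : scalar_space R k)
    \in @bounded_linear R k (dual_space X) (scalar_space R k).
Proof.
apply/bounded_linearP; split=> //.
by exists (rnorm x) => f; rewrite rnorm_bop mulrC; exact: le_opnorm.
Qed.

(** The canonical embedding of X into its bidual. *)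
Definition evaluation (X : normedModType K) (x : X) : dual_space (dual_space X) :=
  Bop (evaluation_subproof x).

Lemma opnorm_evaluation (X : normedModType K) (x : X) : opnorm (evaluation x) <= rnorm x.
Proof.
apply: opnorm_le => [|f]; first exact: rnorm_ge0.
by rewrite rnorm_bop mulrC; exact: (le_opnorm f x).
Qed.

(** The adjoint of T restricted to X inside its bidual. *)
Lemma transpose_exists (X E : normedModType K) (T : bop E (dual_space X)) :
  exists G : bop X (dual_space E), forall x e, G x e = T e x.
Proof.
have ex x : exists g : dual_space E, forall e, g e = T e x.
  have [|e|g gE] := @bounded_op_exists R k E (scalar_space R k) (fun e => T e x)
      (opnorm T * rnorm x).
  - by move=> a u v; rewrite linearP.
  - by rewrite (le_trans (le_opnorm (T e) x))// mulrAC ler_wpM2r ?rnorm_ge0// -rnorm_bop le_opnorm.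
  - by exists g => e; rewrite gE.
have [g gE] := choice ex.
have [|x|G GE] := @bounded_op_exists R k X (dual_space E) g (opnorm T).
- by move=> a u v; apply: bop_ext => e; rewrite bopDE bopZE !gE linearP.
- rewrite rnorm_bop; apply: opnorm_le => [|e]; first by rewrite mulr_ge0 ?opnorm_ge0 ?rnorm_ge0.
  rewrite gE (le_trans (le_opnorm (T e) x))// mulrAC ler_wpM2r ?rnorm_ge0//.
  by rewrite -rnorm_bop le_opnorm.
- by exists G => x e; rewrite GE gE.
Qed.

Lemma seq_coord_sumE N (c : nat -> K) m :
  (\sum_(n < N) c n *: seq_coord R k n) (unit_seq R k m) =
  if (m < N)%N then c m else 0 :> K.
Proof.
have cE n : (c n *: seq_coord R k n) (unit_seq R k m) = c n * (n == m)%:R :> K.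
  by rewrite bopZE seq_coord_unit_seq.
rewrite bop_sumE; under eq_bigr do rewrite cE.
case: ltnP => mN.
  rewrite (bigD1 (Ordinal mN)) //= eqxx mulr1 big1 ?addr0// => i im.
  by rewrite -[(_ == _)%N]/(i == Ordinal mN) (negbTE im) mulr0.
by rewrite big1// => i _; rewrite ltn_eqF ?mulr0// (leq_trans (ltn_ord i) mN).
Qed.

(** As g tends to 0, the adjoint of x |-> (g n x)_n is the norm limit of the
    finite rank operators u |-> sum_(n < N) u(coord n) g n. *)
Lemma adjoint_null_seq_in_ideal (A : op_class R k) (X : banach)
    (g : nat -> dual_space X) (G : bop X (dual_space D)) :
  closed_ideal A -> null_seq g -> (forall x n, G x (unit_seq R k n) = g n x) ->
  A (dual_space (dual_space D)) (dual_space X) (adjoint G).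
Proof.
move=> Acl g0 GE.
pose B N := \sum_(n < N) rank_one (evaluation (seq_coord R k n)) (g n).
apply: (@closed_ideal_limit A _ _ B) => // [N|].
  apply: ideal_finite_rank; first exact: banach_ideal_ideal Acl.
  apply: big_ind => [|S T fS fT|n _]; first exact: finite_rank0.
    by rewrite -[S]scale1r; exact: finite_rankP.
  exact: finite_rank_rank_one.
move=> e e0; have [N0 gN0] := g0 _ e0; exists N0 => N NN0.
rewrite -rnormN opprB rnorm_bop; apply: opnorm_le => [|u]; first exact: ltW.
rewrite !rnorm_bop; apply: opnorm_le => [|x].
  by rewrite mulr_ge0 ?opnorm_ge0 ?ltW.
have -> : (adjoint G - B N) u x =
    u (G x - \sum_(n < N) (g n x : K) *: seq_coord R k n).
  transitivity ((adjoint G u x : K) - (B N u x : K)); first by [].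
  rewrite linearB linear_sum /B bop_sumE bop_sumE.
  congr (_ - _); apply: eq_bigr => n _; rewrite linearZ.
  exact: mulrC.
apply: le_trans (le_opnorm u _) _; rewrite [leRHS]mulrAC [leRHS]mulrC ler_wpM2l ?opnorm_ge0//.
rewrite rnorm_bop; apply: opnorm_fin_seq_le => [|m].
  by rewrite mulr_ge0 ?rnorm_ge0 ?ltW.
rewrite bopBE GE (seq_coord_sumE N (fun n => g n x)).
case: ltnP => [mN|Nm]; first by rewrite subrr rnorm0 mulr_ge0 ?rnorm_ge0 ?ltW.
rewrite subr0; apply: le_trans (le_opnorm _ _) _.
by rewrite ler_wpM2r ?rnorm_ge0// -rnorm_bop gN0// (leq_trans NN0).
Qed.

(** The series converges absolutely in M', and its sum vanishes at every point
    of M because every point is some G x. *)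
Lemma absolutely_summable_null (X M : normedModType K) (G : bop X M)
    (rho : nat -> dual_space M) (z : nat -> K) (C : R) :
  (forall m, exists x, m = G x) -> (forall n, opnorm (rho n) <= 1) ->
  (forall N, \sum_(n < N) rnorm (z n) <= C) ->
  (forall x, seq_lim (fun N => \sum_(n < N) z n * (rho n (G x) : K)) 0) ->
  null_seq (fun N => \sum_(n < N) z n *: rho n).
Proof.
move=> Gsurj rho1 zC zlim e e0.
have [N0 N0P] : exists N0, forall N N', (N0 <= N)%N -> (N <= N')%N ->
    \sum_(N <= n < N') rnorm (z n) <= e.
  pose t N := \sum_(n < N) rnorm (z n).
  have sup_t : has_sup (range t).
    by split; [exists (t 0%N), 0%N|exists C => _ [N _ <-]; exact: zC].
  have [_ [N0 _ <-] tN0] := sup_adherent e0 sup_t.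
  have tE N N' : (N <= N')%N -> t N' = t N + \sum_(N <= n < N') rnorm (z n).
    by move=> NN'; rewrite /t -!(big_mkord xpredT (fun n => rnorm (z n))) -big_cat_nat.
  exists N0 => N N' N0N NN'.
  have : t N' <= sup (range t) by apply: (sup_upper_bound sup_t); exists N'.
  have : t N0 <= t N by rewrite (tE _ _ N0N) lerDl sumr_ge0// => i _; exact: rnorm_ge0.
  by rewrite (tE _ _ NN'); lra.
exists N0 => N N0N; rewrite rnorm_bop; apply: opnorm_le => [|m]; first exact: ltW.
have [x ->] := Gsurj m.
apply/ler_addgt0Pr => d d0; have [N1 N1P] := zlim x _ d0.
pose N' := maxn N N1; have NN' : (N <= N')%N := leq_maxl _ _.
have := N1P N' (leq_maxr _ _); rewrite subr0 => le_d.
rewrite bop_sumE.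
have -> : \sum_(n < N) (z n *: rho n) (G x) =
    \sum_(n < N') z n * (rho n (G x) : K) - \sum_(N <= n < N') z n * (rho n (G x) : K) :> K.
  rewrite -!(big_mkord xpredT (fun n => z n * (rho n (G x) : K))).
  rewrite (@big_cat_nat _ _ _ N 0 N')//= addrK big_mkord.
  by apply: eq_bigr => n _.
apply: le_trans (ler_rnormB _ _) _; rewrite addrC lerD//.
apply: le_trans (ler_rnorm_sum _ _ _) _.
apply: (@le_trans _ _ (\sum_(N <= n < N') rnorm (z n) * rnorm (G x))).
  apply: ler_sum => n _; rewrite rnormM ler_wpM2l ?rnorm_ge0//.
  apply: le_trans (le_opnorm _ _) _.
  by rewrite -[leRHS]mul1r ler_wpM2r ?rnorm_ge0.
by rewrite -mulr_suml ler_wpM2r ?rnorm_ge0// N0P.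
Qed.

(** Uniqueness of the trace: J is the adjoint of the surjection from X onto the
    space of sequences (g n x)_n, rho n is the n-th coordinate functional there
    and J (rho n) = g n.  The trace is tau(J), where
    tau(V) = sum_n zeta n (V (rho n)) is continuous in V, and tau vanishes on
    finite rank operators because the series w f of the zeta n f *: rho n is
    zero. *)
Lemma trace_well_defined (A : op_class R k) (X : banach)
    (g : nat -> dual_space X) (zeta : nat -> dual_space (dual_space X)) (C : R) :
  closed_ideal A -> surjective_ideal A -> has_AP A (@usual_norm R k) (dual_space X) ->
  null_seq g -> (forall N, \sum_(n < N) opnorm (zeta n) <= C) ->
  (forall f x, seq_lim (fun N => \sum_(n < N) (zeta n f : K) * (g n x : K)) 0) ->
  seq_lim (fun N => \sum_(n < N) (zeta n (g n) : K)) 0.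
Proof.
move=> Acl Asurj AP g0 zC zlim.
have [B B0 gB] := null_seq_bounded g0.
have [T TE] := seq_op_exists gB.
have [G GE] := transpose_exists T.
have GgE x n : G x (unit_seq R k n) = g n x by rewrite GE TE.
have AG := adjoint_null_seq_in_ideal Acl g0 GgE.
pose J := adjoint (corestrict G).
have AJ : A (dual_space (range_space G)) (dual_space X) J.
  apply: (Asurj _ _ _ (adjoint (range_incl G)) J).
    exact: restriction_metric_surjection.
  rewrite (_ : comp_op _ _ = adjoint G)//.
  by apply: bop_ext => u; apply: bop_ext => x.
have C0 : 0 <= C by have := zC 0%N; rewrite big_ord0.
have rho_ex n : exists r : dual_space (range_space G),
    forall m, r m = range_val m (unit_seq R k n).
  by exists (comp_op (evaluation (unit_seq R k n)) (range_incl G)).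
have [rho rhoE] := choice rho_ex.
have rho1 n : opnorm (rho n) <= 1.
  apply: opnorm_le => // m; rewrite rhoE mul1r rnorm_range.
  by have := le_opnorm_unit_seq (range_val m) n; rewrite -rnorm_bop.
have Jrho n : J (rho n) = g n.
  by apply: bop_ext => x; rewrite -GgE -[LHS]/(rho n (corestrict G x)) rhoE.
move=> e e0; have e2 : 0 < e / 2 by rewrite divr_gt0.
have d0 : 0 < e / 2 / (C + 1) by rewrite divr_gt0// ltr_wpDl.
have [V Vfin JV] := AP _ _ AJ _ d0.
have [s sP] := finite_rank_interpolate Vfin.
pose w (f : dual_space X) N := \sum_(n < N) (zeta n f : K) *: rho n.
have w0 f : null_seq (w f).
  apply: (@absolutely_summable_null _ _ (corestrict G) rho (fun n => zeta n f : K) (C * opnorm f)) => //.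
  - exact: corestrict_surj.
  - move=> N; rewrite -rnorm_bop; apply: (@le_trans _ _ (\sum_(n < N) opnorm (zeta n) * rnorm f)).
      by apply: ler_sum => n _; exact: le_opnorm.
    by rewrite -mulr_suml ler_wpM2r ?rnorm_ge0.
  - move=> x e' e'0; have [N NP] := zlim f x _ e'0; exists N => n /NP.
    by under eq_bigr do rewrite -GgE; under [in X in _ -> X]eq_bigr do rewrite rhoE.
have tauV N : \sum_(n < N) (zeta n (V (rho n)) : K) =
    \sum_(j <- s) (V (w j.2 N) j.1 : K).
  rewrite (eq_bigr (fun n : 'I_N => \sum_(j <- s) (zeta n j.2 : K) * (V (rho n) j.1 : K))); last first.
    move=> n _; rewrite {1}sP /interpolate linear_sum; apply: eq_bigr => j _.
    by rewrite linearZ; exact: mulrC.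
  rewrite exchange_big /=; apply: eq_bigr => j _.
  rewrite /w linear_sum bop_sumE; apply: eq_bigr => n _.
  by rewrite linearZ.
have tauV0 : null_seq (fun N => \sum_(j <- s) (V (w j.2 N) j.1 : K)).
  apply: null_seq_sum => j.
  apply: (null_seq_le (v := w j.2) (c := opnorm V * rnorm j.1)) (w0 j.2) => N.
  apply: le_trans (le_opnorm _ _) _; rewrite -rnorm_bop mulrAC.
  by rewrite ler_wpM2r ?rnorm_ge0 ?le_opnorm.
have [N0 N0P] := tauV0 _ e2; exists N0 => N N0N; rewrite subr0.
have -> : \sum_(n < N) (zeta n (g n) : K) = \sum_(n < N) (zeta n (V (rho n)) : K) +
    \sum_(n < N) (zeta n ((J - V) (rho n)) : K).
  rewrite -big_split; apply: eq_bigr => n _.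
  by rewrite -[X in _ = X]linearD bopBE Jrho addrC subrK.
apply: le_trans (ler_rnormD _ _) _; rewrite [e]splitr lerD// ?tauV ?N0P//.
apply: le_trans (ler_rnorm_sum _ _ _) _.
apply: (@le_trans _ _ (\sum_(n < N) opnorm (zeta n) * (e / 2 / (C + 1)))).
  apply: ler_sum => n _; apply: le_trans (le_opnorm _ _) _.
  rewrite ler_wpM2l ?opnorm_ge0//; apply: le_trans (le_opnorm _ _) _.
  rewrite -[leRHS]mulr1; apply: ler_pM; rewrite ?opnorm_ge0 ?rnorm_ge0//; first exact: ltW.
  by rewrite rnorm_bop.
rewrite -mulr_suml; apply: (@le_trans _ _ (C * (e / 2 / (C + 1)))).
  exact: ler_wpM2r (ltW d0) _ _ (zC N).
by rewrite mulrA ler_pdivrMr ?ltr_wpDl// mulrC ler_pM2l// lerDl ler01.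
Qed.

End TraceLemma.

(** * Simultaneous approximation of the identities of X and of its dual *)

Section Interleaving.

Definition interleave (T : Type) (a b : nat -> T) (m : nat) : T :=
  if odd m then b m./2 else a m./2.

Lemma interleave_even T (a b : nat -> T) n : interleave a b n.*2 = a n.
Proof. by rewrite /interleave odd_double doubleK. Qed.

Lemma interleave_odd T (a b : nat -> T) n : interleave a b n.*2.+1 = b n.
Proof. by rewrite /interleave /= odd_double /= uphalf_double. Qed.

Lemma sum_double (W : nmodType) (F : nat -> W) N :
  \sum_(m < N.*2) F m = \sum_(n < N) (F n.*2 + F n.*2.+1).
Proof.
elim: N => [|N IH]; first by rewrite !big_ord0.
by rewrite doubleS !big_ord_recr /= IH addrA.
Qed.

Variables (R : realType) (k : scalar_kind).
Local Notation K := (scalar_field R k).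

Lemma null_seq_interleave (F : normedZmodType K) (a b : nat -> F) :
  null_seq a -> null_seq b -> null_seq (interleave a b).
Proof.
move=> a0 b0 e e0; have [N aN] := a0 _ e0; have [N' bN'] := b0 _ e0.
exists (maxn N N').*2 => m mN.
have : (maxn N N' <= m./2)%N by rewrite -(doubleK (maxn N N')) half_leq.
by rewrite geq_max /interleave => /andP[? ?]; case: ifP => _; [exact: bN'|exact: aN].
Qed.

Lemma seq_lim_series_double (W : normedZmodType K) (F : nat -> W) (l : W) :
  null_seq F -> seq_lim (fun N => \sum_(n < N) (F n.*2 + F n.*2.+1)) l ->
  seq_lim (fun N => \sum_(m < N) F m) l.
Proof.
move=> F0 Fl e e0; have e2 : 0 < e / 2 by rewrite divr_gt0.
have [N NP] := Fl _ e2; have [N' N'P] := F0 _ e2.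
exists (maxn N N').*2 => m mN; set n := m./2.
have : (maxn N N' <= n)%N by rewrite -(doubleK (maxn N N')) half_leq.
rewrite geq_max => /andP[Nn N'n].
have le2 : rnorm (\sum_(i < n.*2) F i - l) <= e / 2 by rewrite sum_double NP.
have [om|em] := boolP (odd m); last first.
  have -> : m = n.*2 by rewrite -[LHS]odd_double_half (negbTE em).
  by apply: le_trans le2 _; rewrite ler_pdivrMr// ler_pMr// ler1n.
have -> : m = n.*2.+1 by rewrite -[LHS]odd_double_half om.
rewrite big_ord_recr /= addrAC (le_trans (ler_rnormD _ _))// [e]splitr lerD//.
by rewrite N'P// (leq_trans N'n)// -addnn leq_addr.
Qed.

End Interleaving.

Section Approximation.
Variables (R : realType) (k : scalar_kind).
Local Notation K := (scalar_field R k).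
Local Notation D := (fin_seq R k).
Local Notation banach := (completeNormedModType K).

(** A bounded sequence x n and summable functionals y n define the nuclear
    operator h |-> sum_n h(x n) y n.  Moving part of the norm of y n from one
    factor to the other represents it by a null sequence g and a summable
    sequence xi, the form in which its trace is computed. *)
Lemma null_summable_rescaling (X : normedModType K) (x : nat -> X)
    (y : nat -> dual_space X) (B C : R) :
  (forall n, rnorm (x n) <= B) -> (forall N, \sum_(n < N) opnorm (y n) <= C) ->
  exists (g : nat -> dual_space X) (xi : nat -> dual_space (dual_space X)),
    [/\ null_seq g, exists C', forall N, \sum_(n < N) opnorm (xi n) <= C',
      forall n (h : dual_space X) a,
        (xi n h : K) * (g n a : K) = (h (x n) : K) * (y n a : K) &
      forall n, xi n (g n) = y n (x n) :> K].
Proof.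
move=> xB yC.
have [mu [mu0 mu_gt0 mu_null [C' muC]]] := summable_slack (fun n => opnorm_ge0 (y n)) yC.
pose c n : K := ofR k (mu n / opnorm (y n)).
pose d n : K := ofR k (opnorm (y n) / mu n).
pose g n : dual_space X := c n *: y n.
pose xi n : dual_space (dual_space X) := d n *: evaluation (x n).
have gE n a : g n a = c n * (y n a : K) :> K by [].
have xiE n h : xi n h = d n * (h (x n) : K) :> K by [].
have dc n : y n = 0 \/ d n * c n = 1.
  have [y0|y0] := eqVneq (opnorm (y n)) 0; first by left; exact: opnorm0_eq0.
  have mun : mu n != 0 by rewrite gt_eqF// mu_gt0// lt_neqAle eq_sym y0 opnorm_ge0.
  by right; rewrite -ofRM mulrA divfK// divff// ofR1.
exists g, xi; split=> [e e0||n h a|n].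
- have [N NP] := mu_null _ e0; exists N => n Nn.
  apply: le_trans (NP _ Nn); rewrite rnormZ rnorm_ofR rnorm_bop.
  rewrite ger0_norm ?divr_ge0 ?opnorm_ge0//.
  have [->|y0] := eqVneq (opnorm (y n)) 0; first by rewrite mulr0.
  by rewrite divfK.
- exists (C' * B) => N.
  have B0 : 0 <= B := le_trans (rnorm_ge0 _) (xB 0%N).
  apply: le_trans (ler_wpM2r B0 (muC N)); rewrite mulr_suml.
  apply: ler_sum => n _; rewrite -rnorm_bop rnormZ rnorm_ofR rnorm_bop.
  rewrite ger0_norm ?divr_ge0 ?opnorm_ge0// ler_wpM2l ?divr_ge0 ?opnorm_ge0//.
  exact: le_trans (opnorm_evaluation _) (xB n).
- rewrite gE xiE mulrACA.
  by case: (dc n) => [-> |->]; rewrite ?mul1r// -[(0 : dual_space X) a]/(0 : K) !mulr0.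
- rewrite xiE gE mulrA.
  by case: (dc n) => [-> |->]; rewrite ?mul1r// -[(0 : dual_space X) (x n)]/(0 : K) mulr0.
Qed.

Lemma seq_limD (F : normedZmodType K) (u v : nat -> F) a b :
  seq_lim u a -> seq_lim v b -> seq_lim (fun n => u n + v n) (a + b).
Proof.
move=> ua vb; apply: (null_seq_le (c := 1)) (null_seqD ua vb) => n.
by rewrite mul1r opprD addrACA.
Qed.

Lemma seq_lim_unique (F : normedZmodType K) (u : nat -> F) a b :
  seq_lim u a -> seq_lim u b -> a = b.
Proof.
move=> ua ub; apply/eqP; rewrite -subr_eq0; apply/eqP/(@rnorm0_eq0 R k)/eqP.
rewrite eq_le rnorm_ge0 andbT; apply/ler_addgt0Pr => e e0.
have e2 : 0 < e / 2 by rewrite divr_gt0.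
have [N NP] := ua _ e2; have [N' N'P] := ub _ e2; pose n := maxn N N'.
have -> : a - b = (u n - b) - (u n - a) by rewrite opprB [RHS]addrC addrA subrK.
rewrite add0r [e]splitr (le_trans (ler_rnormB _ _))// lerD//.
  by rewrite N'P// leq_maxr.
by rewrite NP// leq_maxl.
Qed.

(** If no S does it, separate (x, f) from the pairs (S x, S' f) with S of finite
    rank in l^infty(X) * l^infty(X').  Rank one operators turn the separating
    functional phi into the statement that the nuclear operator with data
    (x, y) and (z, f) is zero, whereas phi (x, f) = 1 is its trace. *)
Lemma simultaneous_approximation (A : op_class R k) (X : banach)
    (x : nat -> X) (f : nat -> dual_space X) (e : R) :
  closed_ideal A -> surjective_ideal A -> has_AP A (@usual_norm R k) (dual_space X) ->
  null_seq x -> null_seq f -> 0 < e ->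
  exists S : bop X X, [/\ finite_rank S, forall n, rnorm (S (x n) - x n) <= e &
    forall n, rnorm (adjoint S (f n) - f n) <= e].
Proof.
move=> Acl Asurj AP x0 f0 e0.
have [B B0 xB] := null_seq_bounded x0; have [Bf _ fB] := null_seq_bounded f0.
have [x' x'E] := seq_op_exists xB; have [f' f'E] := seq_op_exists fB.
pose V := (bop D X * bop D (dual_space X))%type.
pose p (v : V) := opnorm v.1 + opnorm v.2.
pose w (S : bop X X) : V := (comp_op S x', comp_op (adjoint S) f').
apply: contrapT => nS.
have far (S : bop X X) : finite_rank S -> e <= p ((x', f') - w S).
  move=> Sfin; rewrite leNgt; apply/negP => pe; apply: nS; exists S; split=> // n.
    apply: le_trans (ltW pe); rewrite -rnormN opprB -x'E.
    apply: le_trans (le_opnorm_unit_seq (x' - comp_op S x') n) _.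
    by rewrite lerDl opnorm_ge0.
  apply: le_trans (ltW pe); rewrite -rnormN opprB -f'E.
  apply: le_trans (le_opnorm_unit_seq (f' - comp_op (adjoint S) f') n) _.
  by rewrite lerDr opnorm_ge0.
have w_lin a S T : w (a *: S + T) = a *: w S + w T.
  congr pair; first by apply: bop_ext.
  apply: bop_ext => d; apply: bop_ext => v.
  rewrite -[LHS]/(f' d (a *: S v + T v)) linearP //.
have [||||||phi [phil phiw phi1 phip]] := @separation R k V p
    [set w S | S in [set S | finite_rank S]] (x', f') e.
- move=> [u v] [u' v']; rewrite /p /= addrACA.
  by apply: lerD; exact: ler_opnormD.
- by move=> a [u v]; rewrite /p /= !opnormZ mulrDr.
- exists 0; first exact: finite_rank0.
  by have := w_lin (-1) 0 0; rewrite scaler0 addr0 scaleN1r addNr.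
- move=> a _ _ [S Sfin <-] [T Tfin <-]; exists (a *: S + T); last exact: w_lin.
  exact: finite_rankP.
- exact: e0.
- by move=> _ [S Sfin <-]; exact: far.
have C0 : 0 <= e^-1 by rewrite invr_ge0 ltW.
have [||y [yC yP]] := @coordinate_functionals R k X (fun u => phi (u, 0)) e^-1 C0.
- move=> a u v; rewrite -phil; congr phi; congr pair.
  by rewrite /= scaler0 addr0.
- by move=> u; apply: le_trans (phip _) _; rewrite /p /= opnorm0 addr0.
have [||z [zC zP]] := @coordinate_functionals R k (dual_space X) (fun v => phi (0, v)) e^-1 C0.
- move=> a u v; rewrite -phil; congr phi; congr pair.
  by rewrite /= scaler0 addr0.
- by move=> u; apply: le_trans (phip _) _; rewrite /p /= opnorm0 add0r.
have phiD u v : phi (u, 0) + phi (0, v) = phi (u, v).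
  rewrite -(linear_mapD _ _ phil); congr phi; congr pair => /=.
    by rewrite addr0.
  by rewrite add0r.
have traceP (S : bop X X) : seq_lim (fun N => \sum_(n < N)
    ((y n (S (x n)) : K) + (z n (adjoint S (f n)) : K))) (phi (w S)).
  have Sx0 : null_seq (fun n => comp_op S x' (unit_seq R k n)).
    apply: (null_seq_le (c := opnorm S)) x0 => n.
    by rewrite -x'E; exact: (le_opnorm S).
  have Sf0 : null_seq (fun n => comp_op (adjoint S) f' (unit_seq R k n)).
    apply: (null_seq_le (c := opnorm (adjoint S))) f0 => n.
    by rewrite -f'E; exact: (le_opnorm (adjoint S) (f' _)).
  have := seq_limD (yP _ Sx0) (zP _ Sf0); rewrite phiD => h d d0.
  have [N NP] := h d d0; exists N => n /NP; rewrite -big_split /=.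
  by under eq_bigr do rewrite x'E f'E.
(* for S = h (x) a, the pair (S x n, S' (f n)) is (h (x n) *: a, f n a *: h) *)
have rank_one_trace (h : dual_space X) (a : X) : seq_lim (fun N => \sum_(n < N)
    ((h (x n) : K) * (y n a : K) + (z n h : K) * (f n a : K))) 0.
  have := traceP (rank_one h a); rewrite phiw; last first.
    by exists (rank_one h a) => //; exact: finite_rank_rank_one.
  move=> H d d0; have [N NP] := H d d0; exists N => n /NP.
  rewrite (eq_bigr (fun n : 'I_n => (h (x n) : K) * (y n a : K) + (z n h : K) * (f n a : K)))//.
  move=> i _; rewrite [X in _ + X](_ : _ = (z i (f i a *: h) : K)); last first.
    by congr (z i _); apply: bop_ext => v; rewrite bopZE -[LHS]/(f i (h v *: a)) linearZ; exact: mulrC.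
  by rewrite linearZ linearZ /=; congr (_ + _); exact: mulrC.
have id_trace : seq_lim (fun N => \sum_(n < N)
    ((y n (x n) : K) + (z n (f n) : K))) 1.
  have := traceP (id_op X); rewrite (_ : w _ = (x', f')) ?phi1.
    move=> H d d0; have [N NP] := H d d0; exists N => n /NP.
    rewrite (eq_bigr (fun n : 'I_n => (y n (x n) : K) + (z n (f n) : K)))// => i _.
    by congr (_ + z i _); apply: bop_ext.
  by congr pair; apply: bop_ext => // d; apply: bop_ext.
have [g [xi [g0 [C' xiC'] xig xigD]]] := null_summable_rescaling xB yC.
have y1 n : opnorm (y n) <= e^-1.
  apply: le_trans (yC n.+1); rewrite (bigD1 ord_max) //= lerDl sumr_ge0// => i _.
  exact: opnorm_ge0.
have z1 n : opnorm (z n) <= e^-1.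
  apply: le_trans (zC n.+1); rewrite (bigD1 ord_max) //= lerDl sumr_ge0// => i _.
  exact: opnorm_ge0.
have trace0 : seq_lim
    (fun N => \sum_(n < N) (interleave xi z n (interleave g f n) : K)) 0.
  apply: (trace_well_defined (C := C' + e^-1) Acl Asurj AP (null_seq_interleave g0 f0)) => [N|h a].
  - apply: (@le_trans _ _ (\sum_(n < N.*2) opnorm (interleave xi z n))).
      rewrite -addnn big_split_ord /= lerDl sumr_ge0// => i _; exact: opnorm_ge0.
    rewrite (sum_double (fun n => opnorm (interleave xi z n))).
    under eq_bigr do rewrite interleave_even interleave_odd.
    by rewrite big_split /= lerD ?xiC' ?zC.
  - pose F n : K := (interleave xi z n h : K) * (interleave g f n a : K).
    apply: (seq_lim_series_double (F := F)).
      apply: (@null_seq_le _ _ _ K _ (interleave (fun n => (h (x n) : K) * (y n a : K))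
          (fun n => (z n h : K) * (f n a : K))) 1).
        move=> n; rewrite mul1r /F /interleave; case: ifP => // _.
        by rewrite xig.
      apply: null_seq_interleave.
        apply: (null_seq_le (c := opnorm h * (e^-1 * rnorm a))) x0 => n.
        rewrite rnormM mulrAC ler_pM ?rnorm_ge0 ?le_opnorm//.
        by apply: le_trans (le_opnorm _ _) _; rewrite ler_wpM2r ?rnorm_ge0.
      apply: (null_seq_le (c := e^-1 * rnorm h * rnorm a)) f0 => n.
      rewrite rnormM [leRHS]mulrAC -[leRHS]mulrA ler_pM ?rnorm_ge0//.
        by apply: le_trans (le_opnorm _ _) _; rewrite ler_wpM2r ?rnorm_ge0.
      by rewrite rnorm_bop; exact: le_opnorm.
    move=> d d0; have [N NP] := rank_one_trace h a d d0; exists N => n /NP.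
    by under [in X in _ -> X]eq_bigr do rewrite /F !interleave_even !interleave_odd xig.
have lim0 : seq_lim (fun N => \sum_(n < N) ((y n (x n) : K) + (z n (f n) : K))) 0.
  move=> d d0; have [N NP] := trace0 d d0; exists N => n nN.
  have := NP n.*2; rewrite -{1}addnn (leq_trans nN (leq_addr _ _)) => /(_ isT).
  rewrite (sum_double (fun n => interleave xi z n (interleave g f n) : K)).
  rewrite (eq_bigr (fun n : 'I_n => (y n (x n) : K) + (z n (f n) : K)))// => i _.
  by rewrite !interleave_even !interleave_odd; congr (_ + _); apply: xigD.
by have := oner_neq0 K; rewrite (seq_lim_unique id_trace lim0) eqxx.
Qed.

End Approximation.

(** * Totally bounded sets and null sequences *)

Lemma interval_net (R : realType) (B e : R) : 0 < e -> exists s : seq R,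
  forall x, `|x| <= B -> exists2 y, y \in s & `|x - y| <= e.
Proof.
move=> e0; exists [seq - B + i%:R * e | i <- iota 0 (Num.truncn (2 * B / e)).+1] => x.
rewrite ler_norml => /andP[Bx xB].
have xe0 : 0 <= (x + B) / e by apply: divr_ge0; [lra|exact: ltW].
have /andP[] := truncn_itv xe0; set i := Num.truncn _ => ix xi.
exists (- B + i%:R * e).
  apply/mapP; exists i => //; rewrite mem_iota /= add0n ltnS /i.
  by apply: le_truncn; rewrite ler_pM2r ?invr_gt0//; lra.
move: ix xi; rewrite ler_pdivlMr// ltr_pdivrMr// -natr1 mulrDl mul1r => ix xi.
rewrite ler_norml; lra.
Qed.

Lemma scalar_net (R : realType) (k : scalar_kind) (B e : R) : 0 < e ->
  exists s : seq (scalar_field R k), forall x, rnorm x <= B ->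
    exists2 y, y \in s & rnorm (x - y) <= e.
Proof.
case: k => e0.
  have [s sP] := interval_net B e0; exists s => x /= xB; exact: sP.
have e2 : 0 < e / 2 by rewrite divr_gt0.
have [s sP] := interval_net B e2.
exists [seq Complex x y | x <- s, y <- s] => -[x1 x2] /= xB.
have [y1 y1s xy1] : exists2 y, y \in s & `|x1 - y| <= e / 2.
  apply: sP; apply: le_trans xB.
  by rewrite -sqrtr_sqr ler_wsqrtr// lerDl sqr_ge0.
have [y2 y2s xy2] : exists2 y, y \in s & `|x2 - y| <= e / 2.
  apply: sP; apply: le_trans xB.
  by rewrite -sqrtr_sqr ler_wsqrtr// lerDr sqr_ge0.
exists (Complex y1 y2); first by apply/allpairsP; exists (y1, y2).
rewrite /rnorm /=.
rewrite -[leRHS]gtr0_norm// -sqrtr_sqr ler_wsqrtr//.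
rewrite -(real_normK (num_real (x1 - y1))) -(real_normK (num_real (x2 - y2))).
have := normr_ge0 (x1 - y1); have := normr_ge0 (x2 - y2); nra.
Qed.

Section TotallyBounded.
Variables (R : realType) (k : scalar_kind).
Local Notation K := (scalar_field R k).

Definition totally_bounded_set (F : normedZmodType K) (A : set F) : Prop :=
  forall e : R, 0 < e -> exists s : seq F,
    forall x, A x -> exists2 y, y \in s & rnorm (x - y) <= e.

Lemma totally_bounded_subset (F : normedZmodType K) (A B : set F) :
  A `<=` B -> totally_bounded_set B -> totally_bounded_set A.
Proof. by move=> AB tB e e0; have [s sP] := tB e e0; exists s => x /AB /sP. Qed.

Lemma totally_bounded_add (F : normedZmodType K) (A B : set F) :
  totally_bounded_set A -> totally_bounded_set B ->
  totally_bounded_set [set x + y | x in A & y in B].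
Proof.
move=> tA tB e e0; have e2 : 0 < e / 2 by rewrite divr_gt0.
have [s sP] := tA _ e2; have [t tP] := tB _ e2.
exists [seq x + y | x <- s, y <- t] => _ [x Ax [y By <-]].
have [x' x's xx'] := sP _ Ax; have [y' y't yy'] := tP _ By.
exists (x' + y'); first by apply/allpairsP; exists (x', y').
by rewrite opprD addrACA (le_trans (ler_rnormD _ _))// [e]splitr lerD.
Qed.

Lemma totally_bounded_approx (F : normedZmodType K) (A : set F) :
  (forall e : R, 0 < e -> exists2 B, totally_bounded_set B &
    forall x, A x -> exists2 y, B y & rnorm (x - y) <= e) ->
  totally_bounded_set A.
Proof.
move=> AB e e0; have e2 : 0 < e / 2 by rewrite divr_gt0.
have [B tB BP] := AB _ e2; have [s sP] := tB _ e2.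
exists s => x /BP [y By xy]; have [z zs yz] := sP _ By; exists z => //.
have -> : x - z = (x - y) + (y - z) by rewrite addrA subrK.
by rewrite (le_trans (ler_rnormD _ _))// [e]splitr lerD.
Qed.

Lemma scalar_ball_totally_bounded (B : R) :
  totally_bounded_set [set c : K | rnorm c <= B].
Proof. by move=> e; exact: scalar_net. Qed.

(** The coefficients of interpolate s f are bounded in terms of the norm of f,
    so one coordinate after the other reduces to nets of scalars. *)
Lemma interpolate_totally_bounded (X : normedModType K) (s : seq (X * dual_space X)) (B : R) :
  totally_bounded_set [set interpolate s f | f in [set f : dual_space X | rnorm f <= B]].
Proof.
elim: s => [|[a h] s IH].
  move=> e e0; exists [:: 0] => _ [f _ <-]; exists 0; rewrite ?mem_head//.
  by rewrite /interpolate big_nil subrr rnorm0 ltW.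
pose A := [set (c : K) *: h | c in [set c : K | rnorm c <= B * rnorm a]].
apply: (@totally_bounded_subset _ _ [set x + y | x in A &
    y in [set interpolate s f | f in [set f : dual_space X | rnorm f <= B]]]).
  move=> _ [f fB <-]; exists ((f a : K) *: h); last first.
    by exists (interpolate s f); [exists f|rewrite /interpolate big_cons].
  exists (f a) => //; apply: le_trans (le_opnorm f a) _.
  by rewrite ler_wpM2r ?rnorm_ge0// -rnorm_bop.
apply: totally_bounded_add IH => e e0.
have h0 : 0 < rnorm h + 1 by rewrite ltr_wpDl ?rnorm_ge0.
have [t tP] := scalar_ball_totally_bounded (B * rnorm a) (divr_gt0 e0 h0).
exists [seq c *: h | c <- t] => _ [c /tP[c' c't cc'] <-].
exists (c' *: h); first exact: map_f.
rewrite -scalerBl rnormZ; apply: le_trans (ler_wpM2r (rnorm_ge0 h) cc') _.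
by rewrite mulrAC ler_pdivrMr// ler_pM2l// lerDl.
Qed.

Lemma finite_rank_ball_totally_bounded (Z X : normedModType K)
    (V : bop Z (dual_space X)) :
  finite_rank V -> totally_bounded_set [set V z | z in [set z | rnorm z <= 1]].
Proof.
move=> /finite_rank_interpolate[s sP].
apply: totally_bounded_subset (interpolate_totally_bounded s (opnorm V)).
move=> _ [z z1 <-]; exists (V z) => //=.
by apply: le_trans (le_opnorm V z) _; rewrite -[leRHS]mulr1 ler_wpM2l ?opnorm_ge0.
Qed.

Lemma compact_totally_bounded (F : normedModType K) (A : set F) :
  compact A -> totally_bounded_set A.
Proof.
rewrite compact_cover => Acov e e0.
have eK : 0 < ofR k e by rewrite ofR_gt0.
have [|x Ax|s _ sA] := Acov F setT (fun x => ball x (ofR k e)).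
- by move=> x _; exact: ball_open.
- by exists x => //; exact: ballxx.
exists (finmap.enum_fset s) => x /sA [y ys]; rewrite -ball_normE /= => yx; exists y => //.
by rewrite -rnormN opprB -(ofR_le k) ofR_rnorm ltW.
Qed.

End TotallyBounded.

Section Hull.
Variables (R : realType) (k : scalar_kind).
Local Notation K := (scalar_field R k).

Lemma half_pow_small (c e : R) : 0 <= c -> 0 < e ->
  exists J, forall j, (J <= j)%N -> c * 2^-1 ^+ j <= e.
Proof.
move=> c0 e0; exists (Num.truncn (c / e)).+1 => j Jj.
have ce0 : 0 <= c / e by rewrite divr_ge0// ltW.
have /andP[_ ce] := truncn_itv ce0.
rewrite exprVn ler_pdivrMr ?exprn_gt0// mulrC -ler_pdivrMr//.
apply: le_trans (ltW ce) _; rewrite -natrX ler_nat.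
by apply: leq_trans Jj _; apply: ltnW; exact: ltn_expl.
Qed.

(** Only finitely many entries come before block J, so that a bijection of the
    pairs (block, position) with natural numbers lists all entries as a null
    sequence. *)
Lemma enumerate_blocks (F : normedZmodType K) (E : nat -> seq F) :
  (forall e : R, 0 < e -> exists J, forall j y, (J <= j)%N -> y \in E j -> rnorm y <= e) ->
  exists2 g : nat -> F, null_seq g & forall j y, y \in E j -> exists n, g n = y.
Proof.
move=> E0.
pose g n : F := if pickle_inv n is Some (j, i) then nth 0 (E j) i else 0.
exists g => [e e0|j y yE].
  have [J JP] := E0 e e0.
  pose N := (\sum_(j < J) \sum_(i < size (E j)) pickle (j : nat, i : nat))%N.
  exists N.+1 => n Nn; rewrite /g; have := @pickle_invK (nat * nat)%type n.
  move: (pickle_inv n) => [[j i]|] /= nE; last by rewrite rnorm0 ltW.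
  have [iE|Ei] := ltnP i (size (E j)); last by rewrite nth_default// rnorm0 ltW.
  have [Jj|jJ] := leqP J j; first by apply: (JP j); rewrite ?mem_nth.
  suff : (n <= N)%N by rewrite leqNgt Nn.
  rewrite -nE /N (bigD1 (Ordinal jJ)) //= (bigD1 (Ordinal iE)) //=.
  by rewrite -addnA leq_addr.
exists (pickle (j, index y (E j))); rewrite /g pickleK_inv nth_index//.
Qed.

(** With approximations y j of a point x of A taken from finite nets of mesh
    4^-j, x is the sum of y 0 and of the increments y (j+1) - y j.  The possible
    terms at level j, finitely many and of norm at most a multiple of 4^-j for
    j > 0, are still small after multiplication by 2^(j+1).  Listed in one
    sequence g, they write x as a combination of terms of g with coefficients
    2^-(j+1), whose sum is 1. *)
Lemma totally_bounded_hull (F : normedModType K) (A : set F) :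
  totally_bounded_set A -> exists2 g : nat -> F, null_seq g &
    forall (G : normedModType K) (U : bop F G) (M : R),
      (forall n, rnorm (U (g n)) <= M) -> forall x, A x -> rnorm (U x) <= M.
Proof.
move=> tA; pose h : R := 2^-1.
have h0 j : 0 < h ^+ j by rewrite exprn_gt0// invr_gt0.
have hS j : h ^+ j.+1 = h ^+ j / 2 by rewrite exprSr.
have [s sP] := choice (fun j => tA (h ^+ j * h ^+ j) (mulr_gt0 (h0 j) (h0 j))).
pose r j := h ^+ j.+1 * h ^+ j.+1 + h ^+ j * h ^+ j.
pose d j : seq F := if j is j'.+1 then
  [seq z <- [seq y - y' | y <- s j'.+1, y' <- s j'] | rnorm z <= r j'] else s 0%N.
pose c j : R := (h ^+ j.+1)^-1.
have c0 j : 0 < c j by rewrite invr_gt0.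
pose E j := [seq ofR k (c j) *: z | z <- d j].
have [e e0|g g0 gE] := enumerate_blocks (E := E).
  have [J JP] := half_pow_small (ler0n R 10) e0.
  exists J.+1 => -[|j] // y Jj /mapP[z]; rewrite mem_filter => /andP[zr _] ->.
  rewrite rnormZ rnorm_ofR gtr0_norm//.
  apply: le_trans (ler_wpM2l (ltW (c0 _)) zr) _; apply: le_trans (JP j Jj).
  rewrite /c /r !hS -/h; have := h0 j; set t := h ^+ j => t0.
  rewrite [leLHS](_ : _ = 5 * t) ?ler_pM2r ?ler_nat//.
  by rewrite /h; field; rewrite gt_eqF.
exists g => // G U M UM x Ax.
have M0 : 0 <= M := le_trans (rnorm_ge0 _) (UM 0%N).
have Ud j z : z \in d j -> rnorm (U z) <= h ^+ j.+1 * M.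
  move=> zd; have [n gn] := gE j (ofR k (c j) *: z) (map_f _ zd).
  have := UM n; rewrite gn linearZ rnormZ rnorm_ofR gtr0_norm//.
  by rewrite /c ler_pdivrMl.
have net_point j : exists y, y \in s j /\ rnorm (x - y) <= h ^+ j * h ^+ j.
  by have [y ys xy] := sP j x Ax; exists y.
have [y yP] := choice net_point.
have yd j : y j.+1 - y j \in d j.+1.
  rewrite mem_filter; apply/andP; split; last first.
    by apply/allpairsP; exists (y j.+1, y j); split=> //=; apply: (yP _).1.
  have -> : y j.+1 - y j = (x - y j) - (x - y j.+1).
    by rewrite opprB [RHS]addrC addrA subrK.
  apply: le_trans (ler_rnormB _ _) _.
  by rewrite addrC lerD// (yP _).2.
have Uy j : rnorm (U (y j)) <= (1 - h ^+ j.+1) * M.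
  elim: j => [|j IH].
    apply: le_trans (Ud 0%N _ (yP 0%N).1) _.
    by rewrite expr1 /h ler_wpM2r//; lra.
  rewrite -(subrK (y j) (y j.+1)) linearD.
  apply: le_trans (ler_rnormD _ _) _.
  apply: le_trans (lerD (Ud _ _ (yd j)) IH) _.
  by rewrite -mulrDl ler_wpM2r//; have := hS j.+1; lra.
apply/ler_addgt0Pr => e e0.
have [J JP] := half_pow_small (opnorm_ge0 U) e0.
rewrite -(subrK (y J) x) linearD addrC.
apply: le_trans (ler_rnormD _ _) _; rewrite lerD//.
  apply: le_trans (Uy J) _.
  by rewrite -[leRHS]mul1r ler_wpM2r// gerBl ltW.
apply: le_trans (le_opnorm _ _) _; apply: le_trans (JP J (leqnn J)).
rewrite ler_wpM2l ?opnorm_ge0// (le_trans (yP J).2)// -/h.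
rewrite -[leRHS]mul1r; apply: ler_wpM2r; first exact: ltW.
by apply: exprn_ile1; rewrite /h; lra.
Qed.

End Hull.

(** * The metric approximation property *)

Section MetricApproximation.
Variables (R : realType) (k : scalar_kind).
Local Notation K := (scalar_field R k).
Local Notation banach := (completeNormedModType K).

Lemma norming_functional (F : normedModType K) (y : F) :
  exists2 u : dual_space F, rnorm u <= 1 & rnorm (u y) = rnorm y.
Proof.
have [->|y0] := eqVneq y 0.
  by exists 0; rewrite rnorm0 ?ler01// rnorm0.
have ny : 0 < rnorm y.
  rewrite lt_neqAle rnorm_ge0 andbT eq_sym.
  by apply: contra_neq y0 => /rnorm0_eq0.
have [||||||f [fl _ f1 fN]] := @separation R k F (fun v => rnorm v) [set 0] y (rnorm y).
- exact: ler_rnormD.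
- exact: rnormZ.
- by [].
- by move=> a _ _ -> ->; rewrite scaler0 addr0.
- exact: ny.
- by move=> _ ->; rewrite subr0.
have [g gE] := bounded_op_exists (Y := scalar_space R k) fl fN.
have nE : rnorm (ofR k (rnorm y)) = rnorm y by rewrite rnorm_ofR ger0_norm ?rnorm_ge0.
exists (ofR k (rnorm y) *: g).
  rewrite rnormZ nE rnorm_bop.
  have : opnorm g <= (rnorm y)^-1.
    by apply: opnorm_le; rewrite ?invr_ge0 ?rnorm_ge0// => v; rewrite gE.
  by move=> /(ler_wpM2l (rnorm_ge0 y)); rewrite divff// gt_eqF.
by rewrite bopZE gE f1 rnormZ nE (rnorm1 R k) mulr1.
Qed.

Lemma opnorm_le_adjoint (X Y : normedModType K) (T : bop X Y) (M : R) :
  0 <= M -> (forall u, rnorm u <= 1 -> rnorm (adjoint T u) <= M) -> opnorm T <= M.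
Proof.
move=> M0 TM; apply: opnorm_le => // x.
have [u u1 <-] := norming_functional (T x).
apply: le_trans (le_opnorm (adjoint T u) x) _.
by rewrite ler_wpM2r ?rnorm_ge0// -rnorm_bop TM.
Qed.

(** T' is a norm limit of finite rank operators, so it maps the unit ball to a
    totally bounded set.  The sequences x and f control C and this image; S' close
    to the identity on f makes (T S - T)' = (S' - 1) T' small in norm. *)
Lemma approximation_along (A : op_class R k) (X Y : banach) (T : bop X Y)
    (C : set X) (e : R) :
  closed_ideal A -> surjective_ideal A -> has_AP A (@usual_norm R k) (dual_space X) ->
  dual_ideal A T -> compact C -> 0 < e ->
  exists S : bop X X, [/\ finite_rank S, forall x, C x -> rnorm (S x - x) <= e &
    opnorm (comp_op T S) <= opnorm T + e].
Proof.
move=> Acl Asurj AP AT /compact_totally_bounded Ctb e0.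
have Ttb : totally_bounded_set [set adjoint T u | u in [set u | rnorm u <= 1]].
  apply: totally_bounded_approx => d d0; have [V Vfin TV] := AP _ _ AT d d0.
  exists [set V u | u in [set u | rnorm u <= 1]].
    exact: finite_rank_ball_totally_bounded.
  move=> _ [u u1 <-]; exists (V u); first by exists u.
  apply: le_trans (le_opnorm (adjoint T - V) u) _.
  by rewrite -[leRHS]mulr1 ler_pM ?opnorm_ge0 ?rnorm_ge0// ltW.
have [x x0 xC] := totally_bounded_hull Ctb.
have [f f0 fT] := totally_bounded_hull Ttb.
have [S [Sfin Sx Sf]] := simultaneous_approximation Acl Asurj AP x0 f0 e0.
exists S; split=> // [a Ca|]; first exact: (xC X (S - id_op X) e Sx a Ca).
rewrite -(subrK T (comp_op T S)) addrC; apply: le_trans (ler_opnormD _ _) _.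
rewrite lerD2l; apply: opnorm_le_adjoint => [|u u1]; first exact: ltW.
rewrite (_ : adjoint _ u = (adjoint S - id_op (dual_space X)) (adjoint T u)).
  by apply: (fT _ (adjoint S - id_op (dual_space X)) e Sf); exists u.
by apply: bop_ext => a; rewrite -[LHS]/(u (T (S a) - T a)) linearB.
Qed.

End MetricApproximation.

Section Directed.
Variables (I : Type) (le : I -> I -> Prop).

Lemma net_filter_filter : directed le -> Filter (net_filter le).
Proof.
move=> [[i0] _ tr ub]; apply: filter_from_filter; first by exists i0.
move=> i j _ _; have [l [il jl]] := ub i j; exists l => // m lm.
by split; [exact: tr il lm|exact: tr jl lm].
Qed.

End Directed.

Theorem proposition3p8 (R : realType) (k : scalar_kind) (A : op_class R k)
    (A_closed : closed_ideal A) (A_surjective : surjective_ideal A)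
    (A_dual_dual : op_class_le A (dual_ideal (dual_ideal A)))
    (X : completeNormedModType (scalar_field R k))
    (X_dual_AP : has_AP A (@usual_norm R k) (dual_space X)) :
  has_MAP (dual_ideal A) (@usual_norm R k) X.
Proof.
move=> Y T AT.
(* the index (C, n) stands for the error 1 / (n + 1) on C *)
pose I := ({C : set X | compact C} * nat)%type.
pose le (i j : I) := sval i.1 `<=` sval j.1 /\ (i.2 <= j.2)%N.
have invn_gt0 n : 0 < n.+1%:R^-1 :> R by rewrite invr_gt0.
have ex (i : I) := approximation_along A_closed A_surjective X_dual_AP AT
  (svalP i.1) (invn_gt0 i.2).
have [S SP] := choice ex.
pose i0 : {C : set X | compact C} := exist _ set0 (@compact0 X).
have dir : directed le.
  split.
  - by constructor; exact: (i0, 0%N).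
  - by move=> i; split.
  - by move=> i j l [ij1 ij2] [jl1 jl2]; split; [exact: subset_trans jl1|exact: leq_trans jl2].
  - move=> i j.
    exists (exist _ (sval i.1 `|` sval j.1) (compactU (svalP i.1) (svalP j.1)), maxn i.2 j.2).
    by split; split=> //=; rewrite ?leq_maxl ?leq_maxr//.
have ff := net_filter_filter dir.
exists I, le, S; split=> //; first by move=> i; have [] := SP i.
  apply/fam_cvgP => C Ccpt P /uniform_nbhs[E [entE EP]].
  move: entE; rewrite -entourage_ballE => -[d /= d0 dE].
  have d'0 : 0 < re d by rewrite -(ofR_gt0 k) ofR_re// ltW.
  pose n := Num.truncn (re d)^-1.
  have nd : n.+1%:R^-1 < re d.
    have /andP[_ h] : n%:R <= (re d)^-1 < n.+1%:R by apply: truncn_itv; rewrite invr_ge0 ltW.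
    by rewrite invf_plt ?posrE.
  exists (exist _ C Ccpt, n) => //= j [jC jn]; apply: EP => x Cx; apply: dE.
  rewrite /= -ball_normE /= -[ltRHS]ofR_re ?ltW// -ofR_rnorm ofR_lt.
  apply: le_lt_trans nd; have [_ /(_ x (jC x Cx)) h _] := SP j.
  rewrite -rnormN opprB; apply: le_trans h _.
  by rewrite lef_pV2 ?posrE// ler_nat.
apply/lee_addgt0Pr => e e0.
pose n := Num.truncn e^-1.
have ne : n.+1%:R^-1 < e.
  have /andP[_ h] : n%:R <= e^-1 < n.+1%:R by apply: truncn_itv; rewrite invr_ge0 ltW.
  by rewrite invf_plt ?posrE.
apply: (@le_trans _ _ (ereal_sup [set (usual_norm (comp_op T (S j)))%:E | j in [set j | le (i0, n) j]])).
  by apply: ereal_inf_lbound; exists (i0, n).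
apply: ge_ereal_sup => _ [j [_ nj] <-]; rewrite -EFinD lee_fin.
have [_ _ h] := SP j; apply: (le_trans h); rewrite lerD2l.
apply: le_trans (ltW ne); by rewrite lef_pV2 ?posrE// ler_nat.
Qed.
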